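(* Assume the Threshold Hypothesis (TH). Then Laver's conjecture $\Sigma=\Omega$ holds; that is, every ordinal in $\Omega$ (every ordinal of the form $u^-\lambda$ with $u\in\mathcal P$ and $\lambda\in\Gamma$) belongs to $\Sigma$.
   Context: Standing assumption: there is a limit ordinal $\Lambda$ and an elementary embedding $j:V_{\Lambda}\to V_{\Lambda}$ that is not the identity; fix $\Lambda$ and $j$. All ordinals are $<\Lambda$. For elementary embeddings $a,b:V_\Lambda\to V_\Lambda$, application is $a\cdot b=ab=\bigcup_{\alpha<\Lambda}a(b\upharpoonright V_\alpha)$ and $\circ$ is composition; $abc=(ab)c$; $a\alpha$ means $a(\alpha)$. $\mathcal A$ is the closure of $\{j\}$ under $\cdot$, and $\mathcal P$ is the closure of $\{j\}$ under $\cdot$ and $\circ$. $\kappa=\mathrm{crit}(j)$ and $\Gamma=\{a\kappa:a\in\mathcal A\}$ (equivalently, the set of critical points of members of $\mathcal A$). For $a\in\mathcal P$ and an ordinal $\alpha$: $a''\alpha=\sup\{a\xi:\xi<\alpha\}$ and $a^-\alpha=\min\{\xi:a\xi\ge\alpha\}$. $\Sigma$ is the closure of $\Gamma$ under the operations $\alpha\mapsto a''\alpha$ ($a\in\mathcal A$); $\Omega$ is the closure of $\Gamma$ under the operations $\alpha\mapsto a^-\alpha$ ($a\in\mathcal A$). It is known that $\Sigma=\{a''\gamma:\gamma\in\Gamma,a\in\mathcal P\}$ and $\Omega=\{a^-\gamma:\gamma\in\Gamma,a\in\mathcal P\}$. Finite algebras: $A_n=\{0,1,\dots,2^n-1\}$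 carries the unique left-distributive operation $*_n$ (i.e. $a*(b*c)=(a*b)*(a*c)$) with $a*_n1=a+1\bmod 2^n$; arguments are read modulo $2^n$. The period $p_n(a)$ is the least $p\ge1$ with $a*_np=0$; it is a power of 2. The threshold $t_n(a)$ is the least $c\geq 1$ with $a*_nc\ge2^{n-1}$ (it exists when $n\ge1$ and $a<2^n-1$). Threshold Hypothesis (TH): for every $n\ge1$ and every $0\le a<2^n-1$, if $p_n(a)=2^k$ and $c+1=t_n(a)$, then $p_{k+1}(c)=2p_k(c)$. *)

(* Defs.v *)
From mathcomp Require Import all_boot.

Set Implicit Arguments.
Unset Strict Implicit.
Unset Printing Implicit Defensive.

(* The ambient universe of sets: a model of ZFC in which foundation and
   replacement hold for arbitrary classes, so that its natural numbers, hence
   first-order formulas, are the standard ones.  [zf_replacement] is stated for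
   partial functional relations and thus includes separation. *)
Record zfc_universe : Type := ZfcUniverse {
  zset :> Type;
  zin : zset -> zset -> Prop;
  zf_extensionality : forall x y, (forall z, zin z x <-> zin z y) -> x = y;
  zf_foundation : well_founded zin;
  zf_pairing : forall x y, exists p, forall z, zin z p <-> z = x \/ z = y;
  zf_union : forall x, exists u, forall z,
    zin z u <-> exists2 y, zin y x & zin z y;
  zf_power : forall x, exists p, forall z,
    zin z p <-> (forall w, zin w z -> zin w x);
  zf_infinity : exists w,
    (exists2 e, zin e w & forall z, ~ zin z e) /\
    (forall n, zin n w ->
       exists2 s, zin s w & forall z, zin z s <-> zin z n \/ z = n);
  zf_replacement : forall x (F : zset -> zset -> Prop),
    (forall y z z', zin y x -> F y z -> F y z' -> z = z') ->
    exists i, forall z, zin z i <-> exists2 y, zin y x & F y z;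
  zf_choice : forall x,
    (forall y, zin y x -> exists z, zin z y) ->
    (forall y y' z, zin y x -> zin y' x -> zin z y -> zin z y' -> y = y') ->
    exists c, forall y, zin y x -> exists! z, zin z y /\ zin z c
}.

Arguments zin {_} _ _.

Notation "x ∈ y" := (zin x y) (at level 70, no associativity).

Definition transitive_set (U : zfc_universe) (x : U) : Prop :=
  forall y z, y ∈ x -> z ∈ y -> z ∈ x.

(* In the presence of foundation, the ordinals are the transitive sets of
   transitive sets. *)
Definition ordinal_set (U : zfc_universe) (x : U) : Prop :=
  transitive_set x /\ forall y, y ∈ x -> transitive_set y.

Definition ole (U : zfc_universe) (x y : U) : Prop := x ∈ y \/ x = y.

Definition limit_ordinal (U : zfc_universe) (L : U) : Prop :=
  [/\ ordinal_set L,
      exists x, x ∈ L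
    & forall x, x ∈ L -> exists2 y, y ∈ L & x ∈ y].

(* [in_V a x] is [x ∈ V_a], where V_a is the union over b < a of the power sets
   of the V_b. *)
Inductive in_V (U : zfc_universe) (a x : U) : Prop :=
  InV b of b ∈ a & (forall y, y ∈ x -> in_V b y).

Record V (U : zfc_universe) (L : U) : Type := MkV {
  vval :> U;
  vvalP : in_V L vval
}.

Inductive formula : Type :=
  | f_mem of nat & nat
  | f_eq of nat & nat
  | f_neg of formula
  | f_and of formula & formula
  | f_ex of nat & formula.

Definition update (T : Type) (v : nat -> T) (i : nat) (x : T) : nat -> T :=
  fun k => if k == i then x else v k.

Fixpoint sat (U : zfc_universe) (L : U) (v : nat -> V L) (f : formula) : Prop :=
  match f with
  | f_mem i k => v i ∈ v k
  | f_eq i k => v i = v k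
  | f_neg g => ~ sat v g
  | f_and g h => sat v g /\ sat v h
  | f_ex i g => exists x : V L, sat (update v i x) g
  end.

Definition elementary (U : zfc_universe) (L : U) (a : V L -> V L) : Prop :=
  forall (f : formula) (v : nat -> V L),
    sat v f <-> sat (fun i => a (v i)) f.

(* p is the Kuratowski pair {{x}, {x, y}} *)
Definition is_pair (U : zfc_universe) (p x y : U) : Prop :=
  forall z, z ∈ p <-> (forall w, w ∈ z <-> w = x) \/
                      (forall w, w ∈ z <-> w = x \/ w = y).

(* r is the restriction of b to V_alpha, as a set of ordered pairs *)
Definition is_restr (U : zfc_universe) (L : U) (b : V L -> V L) (alpha : U)
    (r : V L) : Prop :=
  forall p : U, p ∈ r <-> exists2 x : V L, in_V alpha x & is_pair p x (b x).

(* c = a . b: the graph of c is the union over alpha < L of the sets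
   a (b restricted to V_alpha). *)
Definition is_app (U : zfc_universe) (L : U) (a b c : V L -> V L) : Prop :=
  forall p : U,
    (exists x : V L, is_pair p x (c x)) <->
    (exists alpha : U, exists r : V L,
       [/\ alpha ∈ L, is_restr b alpha r & p ∈ a r]).

Inductive calA (U : zfc_universe) (L : U) (j : V L -> V L) :
    (V L -> V L) -> Prop :=
  | calA_gen : calA j j
  | calA_app a b c of calA j a & calA j b & is_app a b c : calA j c.

Inductive calP (U : zfc_universe) (L : U) (j : V L -> V L) :
    (V L -> V L) -> Prop :=
  | calP_gen : calP j j
  | calP_app a b c of calP j a & calP j b & is_app a b c : calP j c
  | calP_comp a b of calP j a & calP j b : calP j (a \o b).

Definition is_crit (U : zfc_universe) (L : U) (a : V L -> V L)
    (kappa : V L) : Prop :=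
  [/\ ordinal_set kappa, a kappa <> kappa
    & forall xi : V L, xi ∈ kappa -> a xi = xi].

Definition Gamma (U : zfc_universe) (L : U) (j : V L -> V L)
    (gamma : V L) : Prop :=
  exists kappa a, [/\ is_crit j kappa, calA j a & gamma = a kappa].

(* sigma is the supremum of the a xi, xi < alpha *)
Definition is_sup_image (U : zfc_universe) (L : U) (a : V L -> V L)
    (alpha sigma : V L) : Prop :=
  [/\ ordinal_set sigma,
      forall xi : V L, xi ∈ alpha -> ole (a xi) sigma
    & forall tau : V L, ordinal_set tau ->
        (forall xi : V L, xi ∈ alpha -> ole (a xi) tau) -> ole sigma tau].

(* xi is the least ordinal with alpha <= a xi *)
Definition is_min_preimage (U : zfc_universe) (L : U) (a : V L -> V L)
    (alpha xi : V L) : Prop :=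
  [/\ ordinal_set xi,
      ole alpha (a xi)
    & forall eta : V L, ordinal_set eta -> ole alpha (a eta) -> ole xi eta].

Inductive Sigma (U : zfc_universe) (L : U) (j : V L -> V L) : V L -> Prop :=
  | Sigma_Gamma gamma of Gamma j gamma : Sigma j gamma
  | Sigma_sup a alpha sigma of calA j a & Sigma j alpha
      & is_sup_image a alpha sigma : Sigma j sigma.

Inductive Omega (U : zfc_universe) (L : U) (j : V L -> V L) : V L -> Prop :=
  | Omega_Gamma gamma of Gamma j gamma : Omega j gamma
  | Omega_min a alpha xi of calA j a & Omega j alpha
      & is_min_preimage a alpha xi : Omega j xi.

(* The operation of the finite algebra on {0, ..., 2^n - 1}, extended to all
   natural numbers by reading arguments modulo 2^n.  For each n exactly one
   such operation exists. *)
Definition laver_table (n : nat) (op : nat -> nat -> nat) : Prop :=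
  [/\ forall a b, op a b < 2 ^ n,
      forall a b, op a b = op (a %% 2 ^ n) (b %% 2 ^ n),
      forall a b c, op a (op b c) = op (op a b) (op a c)
    & forall a, op a 1 = a.+1 %% 2 ^ n].

Definition is_least (P : pred nat) (m : nat) : Prop :=
  P m /\ forall k, P k -> m <= k.

Definition is_period (op : nat -> nat -> nat) (a p : nat) : Prop :=
  is_least (fun q => (1 <= q) && (op a q == 0)) p.

Definition is_threshold (n : nat) (op : nat -> nat -> nat) (a t : nat) : Prop :=
  is_least (fun c => (1 <= c) && (2 ^ n.-1 <= op a c)) t.

Definition threshold_hypothesis : Prop :=
  forall op : nat -> nat -> nat -> nat,
  (forall n, laver_table n (op n)) ->
  forall n a k c : nat,
    1 <= n -> a < 2 ^ n - 1 ->
    is_period (op n) a (2 ^ k) ->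
    is_threshold n (op n) a c.+1 ->
    forall p p' : nat,
      is_period (op k) c p -> is_period (op k.+1) c p' -> p' = 2 * p.

(* Main.v *)
Require Import Defs.
From mathcomp Require Import all_boot.
From mathcomp Require Import zify.
From Stdlib Require Import Classical ClassicalEpsilon FunctionalExtensionality.

(** Put J_1 = j and J_(i+1) = J_i . j, and let gam n be the critical point of
    J_(2^n).  Everything is reduced to the maps J_i below the ordinals gam n,
    where the finite algebras decide what happens.

    Two embeddings are identified when they agree about membership inside a
    level V_s.  This is a congruence for application and composition
    (agree_appl, agree_appr, agree_comp).  Modulo gam n the class of J_i depends
    exactly on i mod 2^n, these classes are closed under application, and their
    table is A_n (J_mod, J_inj, J_app, op_laver); every member of P is congruent
    to some J_i (calP_tame).  As a . J_(2^m) has critical point a (gam m), the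
    period of a in A_n is 2^m for the least m with J_a (gam m) >= gam n
    (reach_period).  For this dictionary to cover Gamma, the gam n must be
    cofinal in it, which is the Laver-Steel theorem.  Were all the J_n to move
    one limit ordinal s, a subset Y of V_s and a seed p could be chosen such that
    p belongs to J_n Y exactly when p belongs to J_m Y for no m > n, which is
    Yablo's paradox (Laver_Steel).

    The threshold hypothesis enters in below_period.  Let gam k be the least one
    that J_a sends to at least gam N, and let J_a (gam k) overshoot gam N.  Then
    some t = sup J_b[gam m] below gam k is already sent to at least gam N.  With
    c + 1 the threshold of a, the hypothesis says that gam k = J_c (gam m) for
    some m, and b = c works: J_a t is the supremum of the image of J_a (gam m)
    under D = J_a . J_c, and D is congruent modulo gam (N + 1) to an iterate
    of larger index, to which induction applies.

    Now let x be the least ordinal that J_i sends to at least gam N, and let gam k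
    be the least one with x <= gam k.  If x < gam k, below_period provides suprema
    sup J_b[gam l] in the interval [x, gam k); let t be the least one.  If x < t,
    the least ordinal z sent by J_i o J_b to at least gam N lies below gam l, hence
    is by induction on k also a supremum of this kind; then so is J_b z, and
    x <= J_b z < t contradicts the choice of t.  So x = t
    (least_preimage_gam_sup), which puts Omega inside Sigma.

    Conversely, if w has critical point g, then sup a[g] is the least ordinal
    that w sends to at least (w . a) g: for x < g, w (a x) = (w . a) x < (w . a) g,
    whereas w (sup a[g]) is the supremum of (w . a)[w g] and g < w g
    (gam_sup_Omega). *)

Set Implicit Arguments.
Unset Strict Implicit.
Unset Printing Implicit Defensive.

(** * Ordinals and the cumulative hierarchy *)

Section Universe.
Context (U : zfc_universe).
Implicit Types x y z a b : U.

Lemma mem_irr x : ~ x ∈ x.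
Proof. by elim: x / (zf_foundation x) => x _ IH h; exact: (IH x h h). Qed.

Lemma mem_asym x y : x ∈ y -> ~ y ∈ x.
Proof.
elim: x / (zf_foundation x) y => x _ IH y hxy hyx; exact: (IH y hyx x hyx hxy).
Qed.

Lemma ord_mem x y : ordinal_set x -> y ∈ x -> ordinal_set y.
Proof.
move=> [tx hx] yx; split; first exact: hx.
by move=> z zy; apply: hx; apply: tx zy.
Qed.

Lemma ord_trans x y z : ordinal_set z -> x ∈ y -> y ∈ z -> x ∈ z.
Proof. by move=> [tz _] xy yz; apply: tz xy. Qed.

Lemma ord_total x y :
  ordinal_set x -> ordinal_set y -> [\/ x ∈ y, x = y | y ∈ x].
Proof.
elim: x / (zf_foundation x) y => x _ IHx y ox.
elim: y / (zf_foundation y) => y _ IHy oy.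
have [xy|nxy] := classic (x ∈ y); first by constructor 1.
have [yx|nyx] := classic (y ∈ x); first by constructor 3.
constructor 2; apply: zf_extensionality => z; split=> hz.
  have [//|e|yz] := IHx z hz y (ord_mem ox hz) oy; first by case: nyx; rewrite -e.
  by case: nyx; apply: ord_trans yz hz.
have [xz|e|//] := IHy z hz (ord_mem oy hz); last by case: nxy; rewrite e.
by case: nxy; apply: ord_trans xz hz.
Qed.

Lemma ole_or_lt x y : ordinal_set x -> ordinal_set y -> ole x y \/ y ∈ x.
Proof.
move=> ox oy; have [h|h|h] := ord_total ox oy; first by left; left.
  by left; right.
by right.
Qed.

Lemma ole_lt_trans x y z : ordinal_set z -> ole x y -> y ∈ z -> x ∈ z.
Proof. by move=> oz [h|->] // hy; apply: ord_trans h hy. Qed.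

Lemma lt_ole_trans x y z : ordinal_set z -> x ∈ y -> ole y z -> x ∈ z.
Proof. by move=> oz h [hy|<-] //; apply: ord_trans h hy. Qed.

Lemma ole_trans x y z : ordinal_set z -> ole x y -> ole y z -> ole x z.
Proof. by move=> oz h [hy|<-] //; left; apply: ole_lt_trans h hy. Qed.

Lemma ole_anti x y : ole x y -> ole y x -> x = y.
Proof. by move=> [h|->] // [h'|->] //; case: (mem_asym h h'). Qed.

Lemma ole_not_lt x y : ole x y -> ~ y ∈ x.
Proof. by move=> [h|->]; [exact: mem_asym | exact: mem_irr]. Qed.

Lemma ole_sub x y :
  ordinal_set x -> ordinal_set y -> (forall z, z ∈ x -> z ∈ y) -> ole x y.
Proof.
move=> ox oy h; have [//|yx] := ole_or_lt ox oy.
by case: (mem_irr (h _ yx)).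
Qed.

Lemma in_V_mono a b x : (forall c, c ∈ a -> c ∈ b) -> in_V a x -> in_V b x.
Proof. by move=> h [c ca hc]; apply: (InV (h _ ca)). Qed.

Lemma in_V_ole a b x : ordinal_set b -> ole a b -> in_V a x -> in_V b x.
Proof.
move=> ob h; apply: in_V_mono => c ca; exact: lt_ole_trans ca h.
Qed.

Lemma in_V_trans a x y : ordinal_set a -> in_V a x -> y ∈ x -> in_V a y.
Proof.
by move=> oa [b ba hb] yx; apply: in_V_ole (hb _ yx) => //; left.
Qed.

Lemma in_V_sub a x y : in_V a x -> (forall z, z ∈ y -> z ∈ x) -> in_V a y.
Proof. by move=> [b ba hb] h; apply: (InV ba) => z zy; apply/hb/h. Qed.

Lemma in_V_ord a x : ordinal_set a -> x ∈ a -> in_V a x.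
Proof.
elim: x / (zf_foundation x) a => x _ IH a oa xa; apply: (InV xa) => y yx.
exact: (IH y yx x (ord_mem oa xa) yx).
Qed.

Lemma ord_in_V a x : ordinal_set a -> ordinal_set x -> in_V a x -> x ∈ a.
Proof.
move=> oa ox h; elim: h ox => {}a {}x b ba _ IH ox in oa *.
suff: ole x b by move=> hxb; apply: ole_lt_trans hxb ba.
have ob := ord_mem oa ba.
by apply: ole_sub => // z zx; apply: IH => //; apply: ord_mem zx.
Qed.

Lemma ex_Vset a : exists s : U, forall x, x ∈ s <-> in_V a x.
Proof.
elim: a / (zf_foundation a) => a _ IH.
pose F b s := forall z : U, z ∈ s <-> (forall y, y ∈ z -> in_V b y).
have [|i hi] := @zf_replacement U a F.
  by move=> b s s' _ h h'; apply: zf_extensionality => z; rewrite h h'.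
have [u hu] := zf_union i; exists u => x; rewrite hu; split.
  by move=> [s /hi [b ba Fs] /Fs h]; apply: (InV ba).
move=> [b ba h]; have [v hv] := IH b ba; have [p hp] := zf_power v.
exists p.
  by apply/hi; exists b => // z; rewrite hp; split=> + y yz => /(_ y yz) /hv.
by apply/hp => y yx; apply/hv/h.
Qed.

Lemma ex_sep (x : U) (P : U -> Prop) : exists y, forall z, z ∈ y <-> z ∈ x /\ P z.
Proof.
have [|i hi] := @zf_replacement U x (fun y z => y = z /\ P z).
  by move=> y z z' _ [<- _] [<- _].
exists i => z; rewrite hi; split; first by move=> [y yx [<- Py]].
by move=> [zx Pz]; exists z.
Qed.

End Universe.

(** * The structure of sets of rank below a limit ordinal *)

Section Levels.
Context (U : zfc_universe) (L : U) (hL : limit_ordinal L).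
Notation T := (V L).
Implicit Types x y z : T.

Lemma ordL : ordinal_set L. Proof. by case: hL. Qed.
Hint Resolve ordL : core.

Lemma vval_inj x y : vval x = vval y -> x = y.
Proof.
by case: x y => [x px] [y py] /= e; subst y; rewrite (proof_irrelevance _ px py).
Qed.

Lemma ex_mem_V x (z : U) : z ∈ x -> exists z' : T, vval z' = z.
Proof. by move=> zx; exists (MkV (in_V_trans ordL (vvalP x) zx)). Qed.

Lemma extV x y : (forall z, z ∈ x <-> z ∈ y) -> x = y.
Proof.
move=> h; apply/vval_inj/zf_extensionality => z.
split=> zx; have [z' e] := ex_mem_V zx; rewrite -e in zx *; exact/h.
Qed.

Lemma wf_mem : well_founded (fun x y : T => x ∈ y).
Proof.
move=> x; move e: (vval x) => u; elim: u / (zf_foundation u) x e => u _ IH x e.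
by constructor=> y yx; apply: (IH (vval y)) => //; rewrite -e.
Qed.

Lemma in_V_max (x y : U) : in_V L x -> in_V L y ->
  exists b, [/\ b ∈ L, forall z : U, z ∈ x -> in_V b z
            & forall z : U, z ∈ y -> in_V b z].
Proof.
move=> [b bL hb] [c cL hc].
have [h|h] := ole_or_lt (ord_mem ordL bL) (ord_mem ordL cL).
  exists c; split; [exact: cL | move=> z zx | exact: hc].
  exact: (in_V_ole (ord_mem ordL cL) h (hb z zx)).
exists b; split; [exact: bL | exact: hb | move=> z zx].
by apply: (in_V_ole (ord_mem ordL bL) _ (hc z zx)); left.
Qed.

End Levels.

Section LimitLevels.
Context (U : zfc_universe).

Lemma in_V_upair (L x y p : U) : limit_ordinal L -> in_V L x -> in_V L y ->
  (forall z, z ∈ p -> z = x \/ z = y) -> in_V L p.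
Proof.
move=> hL hx hy hp; have [b [bL h1 h2]] := in_V_max hL hx hy.
have [oL _ /(_ b bL) [c cL bc]] := hL.
apply: (InV cL) => z /hp [] ->; first exact: (InV bc h1).
exact: (InV bc h2).
Qed.

Lemma ex_pair (x y : U) : exists p, is_pair p x y.
Proof.
have [s hs] := zf_pairing x x; have [t ht] := zf_pairing x y.
have [p hp] := zf_pairing s t; exists p => z; rewrite hp; split.
  move=> [-> | ->]; [left|right] => w; last exact: ht.
  by rewrite hs; split; [case|left].
move=> [h|h]; [left|right]; apply: zf_extensionality => w; rewrite h.
  by rewrite hs; split; [left|case].
by rewrite ht.
Qed.

Lemma is_pair_uniq (p q x y : U) : is_pair p x y -> is_pair q x y -> p = q.
Proof. by move=> hp hq; apply: zf_extensionality => z; rewrite hp hq. Qed.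

Lemma is_pair_inj (p x y x' y' : U) :
  is_pair p x y -> is_pair p x' y' -> x = x' /\ y = y'.
Proof.
move=> h h'.
have [s hs] := zf_pairing x x; have [t ht] := zf_pairing x y.
have hs1 w : w ∈ s <-> w = x by rewrite hs; split; [case|left].
have sp : s ∈ p by apply/h; left.
have tp : t ∈ p by apply/h; right.
have ex : x = x'.
  have [e|e] := (h' s).1 sp; first by apply/e/hs1.
  by have /hs1 <- : x' ∈ s by apply/e; left.
split=> //; subst x'.
have [s' hs'] := zf_pairing x y'.
have s'p : s' ∈ p by apply/h'; right.
have yt : y ∈ t by apply/ht; right.
have ys : y' ∈ s' by apply/hs'; right.
have [e|e] := (h s').1 s'p.
  have e' := (e y').1 ys; subst y'.
  have [e1|e1] := (h' t).1 tp; first by apply/e1.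
  by have [] := (e1 y).1 yt.
have [e1|e1] := (h' t).1 tp.
  have e2 := (e1 y).1 yt; subst y.
  by have [] := (e y').1 ys.
have [e2|//] := (e1 y).1 yt; subst y.
by have [] := (e y').1 ys.
Qed.

Lemma in_V_pair (L x y p : U) : limit_ordinal L -> is_pair p x y ->
  in_V L p <-> in_V L x /\ in_V L y.
Proof.
move=> hL hp; have [oL _ _] := hL; split.
  move=> h; have [t ht] := zf_pairing x y.
  have tp : t ∈ p by apply/hp; right.
  have tL := in_V_trans oL h tp.
  by split; apply: in_V_trans tL _ => //; apply/ht; [left|right].
move=> [hx hy]; have [s hs] := zf_pairing x x; have [t ht] := zf_pairing x y.
have sL : in_V L s by apply: (in_V_upair hL hx hx) => z /hs.
have tL : in_V L t by apply: (in_V_upair hL hx hy) => z /ht.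
apply: (in_V_upair hL sL tL) => z /hp [] e; [left|right];
  apply: zf_extensionality => w; rewrite e.
  by rewrite hs; split; [left|case].
by rewrite ht.
Qed.

End LimitLevels.

Section Operations.
Context (U : zfc_universe) (L : U) (hL : limit_ordinal L).
Notation T := (V L).
Implicit Types x y z s t : T.

Definition ord x := ordinal_set x.
Definition lim x := limit_ordinal x.

Lemma lim_ord x : lim x -> ord x. Proof. by case. Qed.

Lemma ord_L x : ord x -> vval x ∈ L.
Proof. by move=> ox; apply: ord_in_V (vvalP x) => //; exact: (ordL hL). Qed.

Lemma ex_V (u : U) : in_V L u -> exists x : T, vval x = u.
Proof. by move=> h; exists (MkV h). Qed.

Lemma ex_Vsep x (P : T -> Prop) : exists y, forall z, z ∈ y <-> z ∈ x /\ P z.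
Proof.
have [y hy] := ex_sep x (fun u : U => exists2 z : T, vval z = u & P z).
have [|y' e] := @ex_V y; first by apply: in_V_sub (vvalP x) _ => z /hy [].
exists y' => z; rewrite e hy; split; last by move=> [? ?]; split=> //; exists z.
by move=> [zx [w /vval_inj -> ?]].
Qed.

Definition sep x (P : T -> Prop) : T :=
  proj1_sig (constructive_indefinite_description _ (ex_Vsep x P)).

Lemma in_sep x P z : z ∈ sep x P <-> z ∈ x /\ P z.
Proof.
exact: (proj2_sig (constructive_indefinite_description _ (ex_Vsep x P)) z).
Qed.

Lemma ex_vset x : exists y, ord x -> forall z, z ∈ y <-> in_V x z.
Proof.
have [ox|nox] := classic (ord x); last by exists x.
have [s hs] := ex_Vset x; have [|y e] := @ex_V s.
  by apply: (InV (ord_L ox)) => z /hs.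
by exists y => _ z; rewrite e hs.
Qed.

Definition vset x : T :=
  proj1_sig (constructive_indefinite_description _ (ex_vset x)).

Lemma in_vset x z : ord x -> z ∈ vset x <-> in_V x z.
Proof.
move=> ox; exact: (proj2_sig (constructive_indefinite_description _ (ex_vset x))).
Qed.

Lemma ex_Vpr x y : exists p : T, is_pair p x y.
Proof.
have [p hp] := ex_pair x y; have [|p' e] := @ex_V p.
  by apply/(in_V_pair hL hp); split; apply: vvalP.
by exists p'; rewrite e.
Qed.

Definition pr x y : T :=
  proj1_sig (constructive_indefinite_description _ (ex_Vpr x y)).

Lemma prP x y : is_pair (pr x y) x y.
Proof.
exact: (proj2_sig (constructive_indefinite_description _ (ex_Vpr x y))).
Qed.

Lemma is_pr (p x y : T) : is_pair p x y <-> p = pr x y.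
Proof.
split=> [h|->]; last exact: prP.
by apply: vval_inj; apply: is_pair_uniq h (prP x y).
Qed.

Lemma pr_inj x y x' y' : pr x y = pr x' y' -> x = x' /\ y = y'.
Proof.
move=> e; have h := prP x y; rewrite e in h.
by have [/vval_inj ? /vval_inj ?] := is_pair_inj h (prP x' y').
Qed.

Lemma pr_vset t x y : lim t -> pr x y ∈ vset t <-> x ∈ vset t /\ y ∈ vset t.
Proof.
move=> lt; have ot := lim_ord lt.
by rewrite !in_vset //; apply: in_V_pair lt (prP x y).
Qed.

Lemma vset_trans t x y : ord t -> x ∈ vset t -> y ∈ x -> y ∈ vset t.
Proof. by move=> ot; rewrite !in_vset //; apply: in_V_trans. Qed.

Lemma vset_mono s t x : ord s -> ord t -> ole s t -> x ∈ vset s -> x ∈ vset t.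
Proof. by move=> os ot h; rewrite !in_vset //; apply: in_V_ole. Qed.

Lemma ord_vset t x : ord t -> ord x -> x ∈ vset t <-> x ∈ t.
Proof.
move=> ot ox; rewrite in_vset //; split; first exact: ord_in_V.
exact: in_V_ord.
Qed.

Lemma sub_vset s t x : ord s -> ord t -> s ∈ t ->
  (forall y, y ∈ x -> y ∈ vset s) -> x ∈ vset t.
Proof.
move=> os ot st h; rewrite in_vset //; apply: (InV st) => u ux.
have [y e] := ex_mem_V hL ux; rewrite -e in ux *.
by apply/in_vset => //; apply: h.
Qed.

Lemma lim_succ t s : lim t -> s ∈ t -> exists2 r : T, r ∈ t & s ∈ r.
Proof.
by move=> [_ _ h] /h [r rt sr]; have [r' e] := ex_mem_V hL rt; exists r'; rewrite e.
Qed.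

Lemma ex_rank x : exists2 t : T, ord t & forall y, y ∈ x -> y ∈ vset t.
Proof.
have [b bL hb] := vvalP x; have [|t e] := @ex_V b.
  by apply: in_V_ord bL; exact: (ordL hL).
have ot : ord t by rewrite /ord e; apply: ord_mem bL; exact: (ordL hL).
by exists t => // y yx; rewrite in_vset // e; apply: hb.
Qed.

Lemma ex_succ t : ord t -> exists2 s : T, ord s & t ∈ s.
Proof.
move=> ot; have [_ _ /(_ _ (ord_L ot)) [s sL ts]] := hL.
have [|s' e] := @ex_V s; first by apply: in_V_ord sL; exact: (ordL hL).
exists s'; rewrite /ord e //; apply: ord_mem sL; exact: (ordL hL).
Qed.

Lemma ex_level x : exists2 t : T, ord t & x ∈ vset t.
Proof.
have [t ot h] := ex_rank x; have [s os ts] := ex_succ ot.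
by exists s => //; apply: sub_vset h.
Qed.

Lemma lim_level t x : lim t -> x ∈ vset t ->
  exists s, [/\ s ∈ t, ord s & x ∈ vset s].
Proof.
move=> lt; have ot := lim_ord lt; rewrite in_vset // => - [b bt hb].
have [b' e] := ex_mem_V hL bt; rewrite -e in bt hb.
have [s st bs] := lim_succ lt bt.
have os : ord s by apply: ord_mem st.
exists s; split=> //; rewrite in_vset //; exact: (InV bs).
Qed.

Lemma ex_ord_max s t : ord s -> ord t -> exists r : T, [/\ ole s r, ole t r & r = s \/ r = t].
Proof.
move=> os ot; have [h|h] := ole_or_lt os ot.
  by exists t; split=> //; right.
by exists s; split; [right | left | left].
Qed.

Lemma lim_level2 t x y : lim t -> x ∈ vset t -> y ∈ vset t ->
  exists s, [/\ s ∈ t, ord s, x ∈ vset s & y ∈ vset s].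
Proof.
move=> lt /(lim_level lt) [s [st os xs]] /(lim_level lt) [r [rt o_r yr]].
have [q [sq rq qe]] := ex_ord_max os o_r; exists q.
have oq : ord q by case: qe => ->.
split=> //; first by case: qe => ->.
  exact: vset_mono xs.
exact: vset_mono yr.
Qed.

Lemma ex_least (P : T -> Prop) : (exists x, P x) ->
  exists2 x, P x & forall y, P y -> ~ y ∈ x.
Proof.
move=> [x]; elim: x / (wf_mem x) => x _ IH Px.
have [[y [yx Py]]|h] := classic (exists y, y ∈ x /\ P y); first exact: IH yx Py.
by exists x => // y Py yx; apply: h; exists y.
Qed.

Lemma ex_least_ord (P : T -> Prop) : (exists2 x, ord x & P x) ->
  exists x, [/\ ord x, P x & forall y, ord y -> P y -> ole x y].
Proof.
move=> [x ox Px]; have [|y [oy Py] h] := @ex_least (fun x => ord x /\ P x).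
  by exists x.
exists y; split=> // z oz Pz.
by have [//|zy] := ole_or_lt oy oz; case: (h z).
Qed.

End Operations.

(** * First-order definable relations *)

Section Definability.
Context (U : zfc_universe) (L : U).
Notation T := (V L).
Implicit Types (f g : formula) (v w : nat -> T) (P Q : (nat -> T) -> Prop).

Fixpoint fbound f : nat :=
  match f with
  | f_mem i k | f_eq i k => maxn i.+1 k.+1
  | f_neg g => fbound g
  | f_and g h => maxn (fbound g) (fbound h)
  | f_ex i g => fbound g
  end.

Lemma sat_ext f v w : (forall i, i < fbound f -> v i = w i) ->
  sat v f <-> sat w f.
Proof.
elim: f v w => [i k|i k|g IH|g IHg h IHh|i g IH] v w /= e.
- by rewrite !e ?leq_max ?ltnS ?leqnn ?orbT.
- by rewrite !e ?leq_max ?ltnS ?leqnn ?orbT.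
- by rewrite (IH v w).
- by rewrite (IHg v w) ?(IHh v w) // => l hl; apply: e; rewrite leq_max hl ?orbT.
- have E x : sat (update v i x) g <-> sat (update w i x) g.
    by apply: IH => l hl; rewrite /update e.
  by split=> - [x /E ?]; exists x.
Qed.

(** The bound variable is moved away from the images of the free ones, so that an
    arbitrary renaming causes no capture. *)
Fixpoint ren (r : nat -> nat) f : formula :=
  match f with
  | f_mem i k => f_mem (r i) (r k)
  | f_eq i k => f_eq (r i) (r k)
  | f_neg g => f_neg (ren r g)
  | f_and g h => f_and (ren r g) (ren r h)
  | f_ex i g =>
      let m := (\max_(k < fbound g) r k).+1 in
      f_ex m (ren (fun k => if k == i then m else r k) g)
  end.

Lemma sat_ren f r v : sat v (ren r f) <-> sat (fun i => v (r i)) f.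
Proof.
elim: f r v => [i k|i k|g IH|g IHg h IHh|i g IH] r v //=.
- by rewrite IH.
- by rewrite IHg IHh.
pose m := (\max_(k < fbound g) r k).+1; rewrite -/m; have E x :
    sat (update v m x) (ren (fun k => if k == i then m else r k) g) <->
    sat (update (fun i => v (r i)) i x) g.
  rewrite IH; apply: sat_ext => k hk; rewrite /update.
  have [_|_] := eqVneq k i; first by rewrite eqxx.
  case: eqP => // e; suff: r k < m by rewrite e ltnn.
  by rewrite ltnS (leq_bigmax (Ordinal hk)).
by split=> - [x /E ?]; exists x.
Qed.

(** Relations given by a formula.  Defining them by closure properties avoids
    writing any formula down: the first-order content of a notion is read off
    from the shape of its statement. *)
Definition definable P := exists f, forall v, P v <-> sat v f.

Lemma D_ext P Q : (forall v, P v <-> Q v) -> definable P -> definable Q.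
Proof. by move=> h [f hf]; exists f => v; rewrite -h. Qed.

Lemma D_sat f r : definable (fun v => sat (fun i => v (r i)) f).
Proof. by exists (ren r f) => v; rewrite sat_ren. Qed.

Lemma D_mem i k : definable (fun v => v i ∈ v k). Proof. by exists (f_mem i k). Qed.

Lemma D_eq i k : definable (fun v => v i = v k). Proof. by exists (f_eq i k). Qed.

Lemma D_not P : definable P -> definable (fun v => ~ P v).
Proof. by move=> [f hf]; exists (f_neg f) => v /=; rewrite hf. Qed.

Lemma D_and P Q : definable P -> definable Q -> definable (fun v => P v /\ Q v).
Proof.
by move=> [f hf] [g hg]; exists (f_and f g) => v /=; rewrite hf hg.
Qed.

Lemma D_or P Q : definable P -> definable Q -> definable (fun v => P v \/ Q v).
Proof.
move=> dP dQ; apply: D_ext (D_not (D_and (D_not dP) (D_not dQ))) => v; tauto.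
Qed.

Lemma D_imp P Q : definable P -> definable Q -> definable (fun v => P v -> Q v).
Proof. move=> dP dQ; apply: D_ext (D_or (D_not dP) dQ) => v; tauto. Qed.

Lemma D_iff P Q : definable P -> definable Q -> definable (fun v => P v <-> Q v).
Proof. by move=> dP dQ; apply: D_and; apply: D_imp. Qed.

(** The quantified variable is variable 0 and the others are shifted, as with de
    Bruijn indices; the formula itself quantifies over a fresh name. *)
Lemma D_ex (R : T -> (nat -> T) -> Prop) :
  definable (fun v => R (v 0) (fun n => v n.+1)) -> definable (fun v => exists x, R x v).
Proof.
move=> [f hf]; pose m := fbound f.
pose r n := if n is k.+1 then k else m.
exists (f_ex m (ren r f)) => v /=.
have E x : sat (update v m x) (ren r f) <-> R x v.
  pose w n := if n is k.+1 then v k else x.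
  rewrite -[R x v]/(R (w 0) (fun n => w n.+1)) hf sat_ren; apply: sat_ext.
  case=> [|k] hk /=; rewrite /update ?eqxx //.
  by case: eqP => // e; move: hk; rewrite e ltnNge leqnSn.
by split=> - [x /E ?]; exists x.
Qed.

Lemma D_ex2 (R S : T -> (nat -> T) -> Prop) :
  definable (fun v => R (v 0) (fun n => v n.+1)) ->
  definable (fun v => S (v 0) (fun n => v n.+1)) -> definable (fun v => exists2 x, R x v & S x v).
Proof.
move=> dR dS; apply: D_ext (@D_ex (fun x v => R x v /\ S x v) _) => [v|].
  by split=> [[x [? ?]]|[x ? ?]]; exists x.
exact: D_and.
Qed.

Lemma D_all (R : T -> (nat -> T) -> Prop) :
  definable (fun v => R (v 0) (fun n => v n.+1)) -> definable (fun v => forall x, R x v).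
Proof.
move=> dR; apply: D_ext (D_not (@D_ex (fun x v => ~ R x v) (D_not dR))) => v.
split=> [h x|h [x]]; last by apply.
by apply: NNPP => nR; apply: h; exists x.
Qed.

End Definability.

Ltac definable_step :=
  first [ apply: D_mem | apply: D_eq | apply: D_and | apply: D_or | apply: D_iff
        | apply: D_ex2 | apply: D_ex | apply: D_all | apply: D_not | apply: D_imp ];
  cbv beta.

Section DefinableNotions.
Context (U : zfc_universe) (L : U) (hL : limit_ordinal L).
Notation T := (V L).
Notation pr := (pr hL).
Notation vset := (vset hL).
Implicit Types (x y z s t p r : T) (v w : nat -> T).

Lemma is_pair_V p x y : is_pair p x y <-> forall z, z ∈ p <->
  ((forall w : T, w ∈ z <-> w = x) \/ (forall w : T, w ∈ z <-> w = x \/ w = y)).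
Proof.
have up1 z : (forall w : U, w ∈ z <-> w = vval x) <->
             (forall w : T, w ∈ z <-> w = x).
  split=> h w; first by rewrite h; split=> [/vval_inj|->].
  split=> [wz | ->]; last exact/h.
  by have [w' e] := ex_mem_V hL wz; rewrite -e in wz *; rewrite ((h w').1 wz).
have up z : (forall w : U, w ∈ z <-> w = vval x \/ w = vval y) <->
            (forall w : T, w ∈ z <-> w = x \/ w = y).
  split=> h w.
    by rewrite h; split; case=> [e|e]; [left|right|left|right];
       (exact: vval_inj) || rewrite e.
  split=> [wz | [-> | ->]]; [|by apply/h; left|by apply/h; right].
  have [w' e] := ex_mem_V hL wz; rewrite -e in wz *.
  by case: ((h w').1 wz) => ->; [left|right].
have main (q : T) : is_pair q x y -> forall z, z ∈ q <->
    ((forall w : T, w ∈ z <-> w = x) \/ (forall w : T, w ∈ z <-> w = x \/ w = y)).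
  by move=> hq z; rewrite (hq z) up1 up.
split=> [|h]; first exact: main.
suff -> : p = pr x y by exact: prP.
by apply: (extV hL) => z; rewrite h (main _ (prP hL x y)).
Qed.

Lemma D_pr l i k : definable (fun v : nat -> T => v l = pr (v i) (v k)).
Proof.
apply: D_ext; first by move=> v; rewrite -is_pr; apply: iff_sym; apply: is_pair_V.
by repeat definable_step.
Qed.

Lemma D_prmem i k l : definable (fun v : nat -> T => pr (v i) (v k) ∈ v l).
Proof.
apply: (@D_ext _ _ (fun v => exists2 p : T, p = pr (v i) (v k) & p ∈ v l)).
  by move=> v; split=> [[p -> ]|?] //; exists (pr (v i) (v k)).
apply: D_ex2; [exact: D_pr | exact: D_mem].
Qed.

Lemma ordV x : ord x <-> (forall y z, y ∈ x -> z ∈ y -> z ∈ x) /\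
  (forall y, y ∈ x -> forall z w : T, z ∈ y -> w ∈ z -> w ∈ y).
Proof.
have tr y : transitive_set y <-> (forall z w : T, z ∈ y -> w ∈ z -> w ∈ y).
  split=> [h z w|h z w zy wz]; first exact: h.
  have [z' e] := ex_mem_V hL zy; rewrite -e in zy wz.
  have [w' e'] := ex_mem_V hL wz; rewrite -e' in wz *.
  exact: h zy wz.
rewrite /ord /ordinal_set tr; split=> -[h h']; split=> // y yx.
  by apply/tr/h'.
by have [y' e] := ex_mem_V hL yx; rewrite -e in yx *; apply/tr/h'.
Qed.

Lemma D_ord i : definable (fun v : nat -> T => ord (v i)).
Proof.
apply: D_ext; first by move=> v; apply: iff_sym; apply: ordV.
by repeat definable_step.
Qed.

Lemma limV x : lim x <->
  ord x /\ ((exists y, y ∈ x) /\ forall y, y ∈ x -> exists2 z : T, z ∈ x & y ∈ z).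
Proof.
split=> [[ox [y yx] h]|[ox [[y yx] h]]].
  split=> //; split; first by have [y' e] := ex_mem_V hL yx; exists y'; rewrite e.
  by move=> z /h [w wx zw]; have [w' e] := ex_mem_V hL wx; exists w'; rewrite e.
split=> //; first by exists y.
move=> z zx; have [z' e] := ex_mem_V hL zx; rewrite -e in zx *.
by have [w] := h _ zx; exists w.
Qed.

Lemma D_lim i : definable (fun v : nat -> T => lim (v i)).
Proof.
apply: D_ext; first by move=> v; apply: iff_sym; apply: limV.
by definable_step; [exact: D_ord | repeat definable_step].
Qed.

Lemma pr_two_up r s t x y : ord r -> ord s -> ord t -> r ∈ s -> s ∈ t ->
  x ∈ vset r -> y ∈ vset r -> pr x y ∈ vset t.
Proof.
move=> o_r os ot rs st xr yr; apply: (sub_vset os ot st) => z /(prP hL x y) zE.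
apply: (sub_vset o_r os rs) => w; case: zE => ->; first by move/vval_inj->.
by case=> /vval_inj ->.
Qed.

Lemma pr_level s : ord s -> exists2 r : T, ord r &
  forall x y, x ∈ vset s -> y ∈ vset s -> pr x y ∈ vset r.
Proof.
move=> os; have [s1 os1 s1s] := ex_succ hL os.
have [s2 os2 s21] := ex_succ hL os1; exists s2 => // x y.
exact: (pr_two_up os os1 os2).
Qed.

Lemma ex_level2 x y : exists s, [/\ ord s, x ∈ vset s & y ∈ vset s].
Proof.
have [s os xs] := ex_level hL x; have [t ot yt] := ex_level hL y.
have [q [sq tq qe]] := ex_ord_max os ot.
have oq : ord q by case: qe => ->.
by exists q; split=> //; [apply: vset_mono xs | apply: vset_mono yt].
Qed.

(** The recursion defining the hierarchy is replaced by one set of pairs that is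
    closed under its steps.  By foundation such a set can only record true
    instances, so this is a first-order definition of the hierarchy. *)
Lemma in_V_witness a x : in_V (vval a) (vval x) <->
  exists W : T, (exists2 p : T, p = pr x a & p ∈ W) /\
    forall p, p ∈ W -> exists y b, p = pr y b /\
      exists2 c : T, c ∈ b & forall z, z ∈ y -> exists2 q : T, q = pr z c & q ∈ W.
Proof.
split; last first.
  move=> [W [[p -> paW] hW]].
  elim: x / (wf_mem x) a paW => x _ IH a paW.
  have [y [b [/pr_inj [ex eb] [c ca h]]]] := hW _ paW; subst y b.
  apply: (InV ca) => u ux; have [z e] := ex_mem_V hL ux; rewrite -e in ux *.
  have [q qE qW] := h _ ux; rewrite qE in qW; exact: (IH z ux c qW).
move=> h; have [s [os xs as_]] := ex_level2 x a.
have [r o_r hr] := pr_level os.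
pose W := sep (vset r) (fun p => exists y b,
  [/\ p = pr y b, y ∈ vset s, b ∈ vset s & in_V (vval b) (vval y)]).
exists W; split.
  exists (pr x a) => //; apply/in_sep; split; first exact: hr.
  by exists x, a; split.
move=> p /in_sep [_ [y [b [-> ys bs [c cb hc]]]]]; exists y, b; split=> //.
have [c' e] := ex_mem_V hL cb; rewrite -e in cb hc; exists c' => // z zy.
have zs : z ∈ vset s by apply: vset_trans ys zy.
have cs : c' ∈ vset s by apply: vset_trans bs cb.
exists (pr z c') => //; apply/in_sep; split; first exact: hr.
by exists z, c'; split=> //; apply: hc.
Qed.

Lemma D_inV i k : definable (fun v : nat -> T => in_V (vval (v i)) (vval (v k))).
Proof.
apply: D_ext; first by move=> v; apply: iff_sym; apply: in_V_witness.
by repeat first [exact: D_pr | definable_step].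
Qed.

Lemma vsetV x s : (ord s /\ x = vset s) <->
  (ord s /\ forall z, z ∈ x <-> in_V (vval s) (vval z)).
Proof.
split=> -[os h]; split=> //; first by move=> z; rewrite h in_vset.
by apply: (extV hL) => z; rewrite h in_vset.
Qed.

Lemma D_vset i k : definable (fun v : nat -> T => ord (v k) /\ v i = vset (v k)).
Proof.
apply: D_ext; first by move=> v; apply: iff_sym; apply: vsetV.
by repeat first [exact: D_ord | exact: D_inV | definable_step].
Qed.

End DefinableNotions.

Ltac definable_tac :=
  repeat first [exact: D_pr | exact: D_prmem | exact: D_ord | exact: D_lim
               | exact: D_vset | definable_step].

(** * Elementary embeddings and their application *)

Section Elementary.
Context (U : zfc_universe) (L : U) (hL : limit_ordinal L).
Notation T := (V L).
Notation pr := (pr hL).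
Notation vset := (vset hL).
Implicit Types (x y z s t p r : T) (v w : nat -> T) (a b c : T -> T).

Lemma el_definable a (P : (nat -> T) -> Prop) v :
  elementary a -> definable P -> P v <-> P (fun i => a (v i)).
Proof. by move=> ea [f hf]; rewrite !hf; apply: ea. Qed.

Lemma el1 a (R : T -> Prop) x : elementary a -> definable (fun v => R (v 0)) ->
  R x <-> R (a x).
Proof. by move=> ea d; exact: (el_definable (fun _ => x) ea d). Qed.

Lemma el2 a (R : T -> T -> Prop) x y :
  elementary a -> definable (fun v => R (v 0) (v 1)) -> R x y <-> R (a x) (a y).
Proof. by move=> ea d; exact: (el_definable (fun i => nth x [:: x; y] i) ea d). Qed.

Lemma el3 a (R : T -> T -> T -> Prop) x y z : elementary a ->
  definable (fun v => R (v 0) (v 1) (v 2)) -> R x y z <-> R (a x) (a y) (a z).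
Proof. by move=> ea d; exact: (el_definable (fun i => nth x [:: x; y; z] i) ea d). Qed.

Section One.
Context (a : T -> T) (ea : elementary a).

Lemma el_mem x y : x ∈ y <-> a x ∈ a y.
Proof. by apply: (el2 (R := fun x y => x ∈ y)) => //; definable_tac. Qed.

Lemma el_inj x y : a x = a y -> x = y.
Proof. by move/(el2 (R := fun x y => x = y) x y ea (D_eq _ 0 1)). Qed.

Lemma el_pr x y : a (pr x y) = pr (a x) (a y).
Proof.
exact: (el3 (R := fun p x y => p = pr x y) _ _ _ ea (D_pr hL 0 1 2)).1.
Qed.

Lemma el_prmem x y r : pr x y ∈ r <-> pr (a x) (a y) ∈ a r.
Proof. by rewrite -el_pr -el_mem. Qed.

Lemma el_ord x : ord x <-> ord (a x).
Proof. by apply: el1 => //; definable_tac. Qed.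

Lemma el_lim x : lim x <-> lim (a x).
Proof. by apply: el1 => //; exact: D_lim. Qed.

Lemma el_vset s : ord s -> a (vset s) = vset (a s).
Proof.
move=> os.
by have [_] := (el2 (R := fun x s => ord s /\ x = vset s) (vset s) s ea
                    (D_vset hL 0 1)).1 (conj os erefl).
Qed.

Lemma el_ole s t : ole s t -> ole (a s) (a t).
Proof. by case=> [/el_mem|/vval_inj ->]; [left|right]. Qed.

(** An ordinal moved down would be followed by its own image, moved down again. *)
Lemma el_infl s : ord s -> ole s (a s).
Proof.
elim: s / (wf_mem s) => s _ IH os.
have [//|h] := ole_or_lt os ((el_ord s).1 os).
have oas := ord_mem os h.
have := IH _ h oas; have := (el_mem _ _).1 h => h1 h2.
by case: (ole_not_lt h2 h1).
Qed.

Lemma el_sub x y : (forall z, z ∈ x -> z ∈ y) -> forall z, z ∈ a x -> z ∈ a y.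
Proof.
have d : definable (fun v : nat -> T => forall z : T, z ∈ v 0 -> z ∈ v 1) by definable_tac.
exact: (el2 (R := fun x y => forall z, z ∈ x -> z ∈ y) _ _ ea d).1.
Qed.

Lemma vset_infl s x : ord s -> x ∈ vset s -> x ∈ vset (a s).
Proof. by move=> os; exact: (vset_mono os ((el_ord s).1 os) (el_infl os)). Qed.

End One.
End Elementary.

Section Closure.
Context (U : zfc_universe) (L : U).
Notation T := (V L).
Implicit Types (f g : formula) (v w : nat -> T) (P Q : (nat -> T) -> Prop).

Fixpoint close_from_1 m f : formula :=
  if m is k.+1 then f_neg (f_ex m (f_neg (close_from_1 k f))) else f.

Lemma sat_close_from_1 m f v : sat v (close_from_1 m f) <->
  forall w, (forall k, (k == 0) || (m < k) -> w k = v k) -> sat w f.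
Proof.
elim: m v => [|m IH] v /=.
  split=> [h w hw|]; last by apply.
  by apply/(sat_ext (w := v)) => // i _; apply: hw; case: i.
have E x : ~ sat (update v m.+1 x) (f_neg (close_from_1 m f)) <->
    sat (update v m.+1 x) (close_from_1 m f) by split=> /= [/NNPP|h].
split=> [h w hw|h [x]].
  have /IH := NNPP _ (not_ex_all_not _ _ h (w m.+1)); apply=> k hk.
  rewrite /update; case: eqP => [-> //|/eqP ne]; apply: hw.
  case/orP: hk => [-> //|]; rewrite leq_eqVlt => /orP [/eqP e|->].
    by rewrite e eqxx in ne.
  by rewrite orbT.
case; apply/IH => w hw; apply: h => k hk; rewrite hw; last first.
  by case/orP: hk => [->//|/ltnW ->]; rewrite orbT.
rewrite /update; case: eqP => // e; move: hk; rewrite e /= ltnn; by [].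
Qed.

(** Only finitely many variables of a formula matter, so quantifying over whole
    valuations is a finite block of quantifiers.  This makes it a first-order
    statement about a set map that it preserves a given formula. *)
Lemma D_univ P : definable P -> definable (fun v => forall w, w 0 = v 0 -> P w).
Proof.
move=> [f hf]; exists (close_from_1 (fbound f) f) => v; rewrite sat_close_from_1; split=> h w hw.
  by apply/hf/h/hw.
pose w' k := if (k == 0) || (fbound f < k) then v k else w k.
apply/hf; apply/(sat_ext (w := w')).
  move=> i hi; rewrite /w' ltnNge ltnW //= orbF.
  by case: eqP => // ->.
by apply: h => k hk; rewrite /w' hk.
Qed.

Lemma D_bounded n (R : nat -> (nat -> T) -> Prop) : (forall i, definable (R i)) ->
  definable (fun v => forall i, i < n -> R i v).
Proof.
move=> dR; elim: n => [|n IH].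
  by apply: D_ext (D_imp (D_not (D_eq L 0 0)) (dR 0)) => v; split.
apply: D_ext (D_and IH (dR n)) => v; split=> [[h hn] i|h].
  by rewrite ltnS leq_eqVlt => /orP [/eqP ->|/h].
by split=> [i hi|]; apply: h => //; apply: ltnW.
Qed.

End Closure.

Section Application.
Context (U : zfc_universe) (L : U) (hL : limit_ordinal L).
Notation T := (V L).
Notation pr := (pr hL).
Notation vset := (vset hL).
Implicit Types (x y z s t p r M : T) (v w : nat -> T) (a b c : T -> T).

Definition graph_on b M r := forall p, p ∈ r <-> exists2 x : T, x ∈ M & p = pr x (b x).

Lemma graph_on_pr b M r x y : graph_on b M r -> pr x y ∈ r <-> x ∈ M /\ y = b x.
Proof.
move=> h; rewrite h; split=> [[x' x'M /pr_inj [-> ->]]|[xM ->]]; first by split.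
by exists x.
Qed.

Lemma ex_graph_on b s : elementary b -> ord s -> exists r, graph_on b (vset s) r.
Proof.
move=> eb os; have obs : ord (b s) by exact: (el_ord hL eb s).1.
have [r o_r hr] := pr_level hL obs.
exists (sep (vset r) (fun p => exists2 x : T, x ∈ vset s & p = pr x (b x))) => p.
rewrite in_sep; split=> [[]|] // [x xs ->]; split; last by exists x.
by apply: hr; [exact: vset_infl | rewrite -el_vset // -el_mem].
Qed.

(** A definable surrogate for graph_on, whose embedding b is not a set. *)
Definition is_fun r M := (forall p, p ∈ r -> exists2 x : T, x ∈ M & exists y, p = pr x y) /\
  (forall x, x ∈ M -> exists2 y : T, pr x y ∈ r & forall z, pr x z ∈ r -> z = y).

Lemma D_is_fun i k : definable (fun v : nat -> T => is_fun (v i) (v k)).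
Proof. by rewrite /is_fun; definable_tac. Qed.

Lemma graph_on_fun b M r : graph_on b M r -> is_fun r M.
Proof.
move=> h; split=> [p /h [x xM ->]|x xM]; first by exists x => //; exists (b x).
by exists (b x); [apply/(graph_on_pr _ _ h) | move=> z /(graph_on_pr _ _ h) []].
Qed.

Lemma el_fun a r M : elementary a -> is_fun r M -> is_fun (a r) (a M).
Proof.
by move=> ea; apply: (el2 (R := is_fun) _ _ ea (D_is_fun 0 1)).1.
Qed.

(** The restrictions of b to the levels increase, so their images under a are
    functions that extend each other, on domains that exhaust the structure. *)
Lemma ex_app a b x : exists y, elementary a -> elementary b ->
  forall s r, ord s -> graph_on b (vset s) r -> x ∈ vset (a s) ->
  forall z, pr x z ∈ a r <-> z = y.
Proof.
have [ea|] := classic (elementary a); last by exists x.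
have [eb|] := classic (elementary b); last by exists x.
have [s os xs] := ex_level hL x; have [r hr] := ex_graph_on eb os.
have [_ /(_ x) hx] := el_fun ea (graph_on_fun hr).
have [|y xy yu] := hx; first by rewrite el_vset //; apply: vset_infl.
exists y => _ _ t q ot hq xt z.
have [_ /(_ x) hx'] := el_fun ea (graph_on_fun hq).
have [|y' xy' yu'] := hx'; first by rewrite el_vset.
suff e : y' = y by split=> [/yu' ->|->] //; rewrite -e.
have sub s1 s2 r1 r2 : graph_on b (vset s1) r1 -> graph_on b (vset s2) r2 -> ord s1 ->
    ord s2 -> ole s1 s2 -> forall p, p ∈ a r1 -> p ∈ a r2.
  move=> h1 h2 o1 o2 le; apply: el_sub => // p /h1 [u us ->]; apply/h2.
  by exists u => //; apply: vset_mono us.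
have [h|h] := ole_or_lt os ot.
  by apply/esym/yu'; apply: (sub s t r q).
by apply: yu; apply: (sub t s q r) => //; left.
Qed.

Definition app a b x : T :=
  proj1_sig (constructive_indefinite_description _ (ex_app a b x)).

Lemma appP a b x s r z : elementary a -> elementary b -> ord s ->
  graph_on b (vset s) r -> x ∈ vset (a s) -> pr x z ∈ a r <-> z = app a b x.
Proof.
move=> ea eb os hr xs.
exact: (proj2_sig (constructive_indefinite_description _ (ex_app a b x))
          ea eb s r os hr xs z).
Qed.

Lemma graph_on_app a b s r : elementary a -> elementary b -> ord s ->
  graph_on b (vset s) r -> graph_on (app a b) (vset (a s)) (a r).
Proof.
move=> ea eb os hr p; split=> [pr_|[x xs ->]]; last first.
  by apply/(appP _ ea eb os hr).
have [/(_ p pr_) [x]] := el_fun ea (graph_on_fun hr).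
rewrite el_vset // => xs [y e] _; exists x => //; rewrite e; congr (pr _ _).
by apply/(appP _ ea eb os hr) => //; rewrite -e.
Qed.

Lemma app_comm a b x : elementary a -> elementary b ->
  app a b (a x) = a (b x).
Proof.
move=> ea eb; have [s os xs] := ex_level hL x; have [r hr] := ex_graph_on eb os.
apply/esym/(appP _ ea eb os hr); first by rewrite -el_vset // -el_mem.
by rewrite -el_prmem //; apply/(graph_on_pr _ _ hr).
Qed.

(** That the restriction r of b to a level preserves a formula f is a first-order
    property of r.  So a r preserves f as well, and a . b is the union of the
    maps a r. *)
Lemma app_elementary a b : elementary a -> elementary b -> elementary (app a b).
Proof.
move=> ea eb f v; pose n := fbound f.
pose P w := (forall i, i < n -> pr (w i.*2.+1) (w i.*2.+2) ∈ w 0) ->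
  (sat (fun i => w i.*2.+1) f <-> sat (fun i => w i.*2.+2) f).
have dP : definable P.
  apply: D_imp; last by apply: D_iff; apply: D_sat.
  by apply: D_bounded => i; apply: D_prmem.
have [s os hs] : exists2 s, ord s & forall i, i < n -> v i ∈ vset s.
  elim: (n) => [|m [s os hs]]; first by have [s os _] := ex_level hL (v 0); exists s.
  have [t ot vt] := ex_level hL (v m); have [q [sq tq qe]] := ex_ord_max os ot.
  have oq : ord q by case: qe => ->.
  exists q => // i; rewrite ltnS leq_eqVlt => /orP [/eqP ->|/hs h].
    exact: vset_mono vt.
  exact: vset_mono h.
have [r hr] := ex_graph_on eb os.
have Pr : forall w, w 0 = r -> P w.
  move=> w w0 hw; rewrite (eb f (fun i => w i.*2.+1)); apply: sat_ext => i hi.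
  by have := hw i hi; rewrite w0 => /(graph_on_pr _ _ hr) [_ ->].
have par : forall w, w 0 = a r -> P w.
  exact: (el1 (R := fun r => forall w, w 0 = r -> P w) r ea (D_univ dP)).1.
pose c := app a b.
(* Variable 0 holds the set map, odd variables the arguments, and the other even
   variables their images. *)
pose w k := if k is k'.+1 then if odd k' then c (v k'./2) else v k'./2 else a r.
have w1 i : w i.*2.+1 = v i by rewrite /= odd_double doubleK.
have w2 i : w i.*2.+2 = c (v i) by rewrite /= odd_double /= uphalf_double.
have := par w erefl; rewrite /P.
have -> : (fun i => w i.*2.+1) = v by apply: functional_extensionality => i.
have -> : (fun i => w i.*2.+2) = (fun i => c (v i)).
  by apply: functional_extensionality => i.
apply=> i hi; rewrite w1 w2; apply/(appP _ ea eb os hr) => //.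
by apply: vset_infl => //; apply: hs.
Qed.

Lemma is_restr_graph_on b s r : ord s -> is_restr b s r <-> graph_on b (vset s) r.
Proof.
move=> os; split=> h.
  move=> p; rewrite h; split=> -[x xs /is_pr e]; exists x => //.
    exact/in_vset.
  by apply/in_vset.
move=> p; split=> [pr_|[x xs hp]].
  have [p' e] := ex_mem_V hL pr_; rewrite -e in pr_ *.
  by have [x xs ->] := (h p').1 pr_; exists x; [apply/in_vset|apply: prP].
have e : p = pr x (b x) := is_pair_uniq hp (prP hL x (b x)).
by rewrite e; apply/h; exists x => //; apply/in_vset.
Qed.

Lemma is_app_app a b : elementary a -> elementary b -> is_app a b (app a b).
Proof.
move=> ea eb p; split=> [[x hp]|[s [r [sL hr pr_]]]].
  have -> : p = pr x (app a b x) := is_pair_uniq hp (prP hL _ _).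
  have [s os xs] := ex_level hL x; have [r hr] := ex_graph_on eb os.
  exists s, r; split; [exact: ord_L | exact/is_restr_graph_on |].
  by apply/(appP _ ea eb os hr) => //; apply: vset_infl.
have [s' e] : exists s' : T, vval s' = s.
  by apply: (@ex_V U L); apply: (in_V_ord (ordL hL)).
have os : ord s' by rewrite /ord e; apply: ord_mem sL; exact: (ordL hL).
rewrite -e in hr; move/(is_restr_graph_on _ _ os): hr => hr.
have [p' ep] := ex_mem_V hL pr_; rewrite -ep in pr_ *.
have [x _ ->] := (graph_on_app ea eb os hr p').1 pr_.
by exists x; apply: prP.
Qed.

Lemma app_unique a b c : elementary a -> elementary b -> is_app a b c -> c = app a b.
Proof.
move=> ea eb h; apply: functional_extensionality => x.
have [x' hx] : exists x' : T, is_pair (pr x (app a b x)) x' (c x').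
  by apply/h/(is_app_app ea eb); exists x; apply: prP.
by have [/vval_inj e /vval_inj <-] := is_pair_inj hx (prP hL _ _); rewrite e.
Qed.

(** Both sides are the union of the sets a (b r), for r the restrictions of c. *)
Lemma app_LD a b c : elementary a -> elementary b -> elementary c ->
  app a (app b c) = app (app a b) (app a c).
Proof.
move=> ea eb ec; apply: functional_extensionality => x.
have ebc := app_elementary eb ec; have eab := app_elementary ea eb.
have eac := app_elementary ea ec.
have [s os xs] := ex_level hL x; have [r hr] := ex_graph_on ec os.
have obs : ord (b s) by exact: (el_ord hL eb s).1.
have oas : ord (a s) by exact: (el_ord hL ea s).1.
have h1 := graph_on_app ea ebc obs (graph_on_app eb ec os hr).
have h2 := graph_on_app eab eac oas (graph_on_app ea ec os hr).
rewrite !app_comm // in h2.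
have xS : x ∈ vset (a (b s)).
  by apply: vset_infl => //; apply: vset_infl.
apply/esym.
have /(graph_on_pr _ _ h2) : pr x (app a (app b c) x) ∈ a (b r) by apply/(graph_on_pr _ _ h1).
by case.
Qed.

Lemma comp_elementary a b : elementary a -> elementary b -> elementary (a \o b).
Proof. by move=> ea eb f v; rewrite (eb f v) (ea f). Qed.

Lemma comp_app a b : elementary a -> elementary b ->
  a \o b = app a b \o a.
Proof.
by move=> ea eb; apply: functional_extensionality => x /=; rewrite app_comm.
Qed.

End Application.

(** * Agreement of embeddings on a level *)

Section Congruence.
Context (U : zfc_universe) (L : U) (hL : limit_ordinal L).
Notation T := (V L).
Notation pr := (pr hL).
Notation vset := (vset hL).
Notation graph_on := (graph_on hL).
Notation app := (app hL).
Implicit Types (x y z s t p q r k M : T) (a b c : T -> T).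

Lemma ord_el a s : elementary a -> ord s -> ord (a s).
Proof. by move=> ea; exact: (el_ord hL ea s).1. Qed.

Lemma lim_el a s : elementary a -> lim s -> lim (a s).
Proof. by move=> ea; exact: (el_lim hL ea s).1. Qed.

(** The part of b visible inside M.  Unlike graph_on b M, it is a subset of M when M
    is a limit level, so it can be fed to embeddings that only reach slightly
    above M. *)
Definition trace_on b M q := forall p, p ∈ q <->
  exists x y, [/\ p = pr x y, x ∈ M, y ∈ M & y ∈ b x].

Lemma trace_on_pr b M q x y : trace_on b M q ->
  pr x y ∈ q <-> [/\ x ∈ M, y ∈ M & y ∈ b x].
Proof.
move=> h; rewrite h; split=> [[x' [y' [/pr_inj [-> ->]]]]|[xM yM yx]] //.
by exists x, y.
Qed.

Lemma ex_trace_on b s t : ord t ->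
  (forall x y, x ∈ vset s -> y ∈ vset s -> pr x y ∈ vset t) ->
  exists q, trace_on b (vset s) q /\ forall p, p ∈ q -> p ∈ vset t.
Proof.
move=> ot ht; pose P p := exists x y, [/\ p = pr x y, x ∈ vset s, y ∈ vset s & y ∈ b x].
exists (sep (vset t) P); split=> p; last by move/in_sep => [].
rewrite in_sep; split=> [[]|] // h; split=> //.
by have [x [y [-> xs ys _]]] := h; apply: ht.
Qed.

Lemma trace_on_app a b s q : elementary a -> elementary b -> ord s ->
  trace_on b (vset s) q -> trace_on (app a b) (vset (a s)) (a q).
Proof.
move=> ea eb os hq; have [r hr] := ex_graph_on hL eb os.
pose R q M r := forall p, p ∈ q <-> exists x y, p = pr x y /\
  (x ∈ M /\ (y ∈ M /\ exists z, pr x z ∈ r /\ y ∈ z)).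
have dR : definable (fun v : nat -> T => R (v 0) (v 1) (v 2)) by rewrite /R; definable_tac.
have : R q (vset s) r.
  move=> p; rewrite hq; split=> -[x [y]].
    move=> [-> xs ys yx]; exists x, y; do !split=> //.
    by exists (b x); split=> //; apply/(graph_on_pr _ _ hr).
  move=> [-> [xs [ys [z [/(graph_on_pr _ _ hr) [_ ->] yx]]]]].
  by exists x, y.
move/(el3 _ _ _ ea dR); rewrite el_vset // => h p.
have hr' := graph_on_app ea eb os hr.
rewrite h; split=> -[x [y]].
  move=> [-> [xs [ys [z [/(graph_on_pr _ _ hr') [_ ->] yx]]]]].
  by exists x, y.
move=> [-> xs ys yx]; exists x, y; do !split=> //.
by exists (app a b x); split=> //; apply/(graph_on_pr _ _ hr').
Qed.

(** Laver's equivalence of embeddings. *)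
Definition agree s a b := forall x y, x ∈ vset s -> y ∈ vset s -> y ∈ a x <-> y ∈ b x.

Lemma agree_refl s a : agree s a a. Proof. by []. Qed.

Lemma agree_sym s a b : agree s a b -> agree s b a.
Proof. by move=> h x y xs ys; rewrite h. Qed.

Lemma agree_trans s a b c : agree s a b -> agree s b c -> agree s a c.
Proof. by move=> h h' x y xs ys; rewrite h // h'. Qed.

Lemma agree_le s t a b : ord s -> ord t -> ole s t -> agree t a b -> agree s a b.
Proof.
by move=> os ot le h x y xs ys; apply: h; [apply: vset_mono xs|apply: vset_mono ys].
Qed.

(** Agreement of b and b' on a level is equality of two sets, to which a applies. *)
Lemma agree_appl a b b' s : elementary a -> elementary b -> elementary b' -> ord s ->
  agree s b b' -> agree (a s) (app a b) (app a b').
Proof.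
move=> ea eb eb' os h; have [t ot ht] := pr_level hL os.
have [q [hq _]] := ex_trace_on b ot ht.
have hq' : trace_on b' (vset s) q.
  move=> p; rewrite hq; split=> -[x [y [-> xs ys yx]]]; exists x, y; split=> //.
    exact/h.
  exact/(h x y xs ys).
have h1 := trace_on_app ea eb os hq; have h2 := trace_on_app ea eb' os hq'.
move=> x y xs ys; split=> yx.
  by have /(trace_on_pr _ _ h2) [] : pr x y ∈ a q by apply/(trace_on_pr _ _ h1).
by have /(trace_on_pr _ _ h1) [] : pr x y ∈ a q by apply/(trace_on_pr _ _ h2).
Qed.

Lemma ord_lim_mem s t : lim s -> t ∈ s -> ord t.
Proof. by move/lim_ord => os; apply: ord_mem. Qed.

Lemma pr_level_lim s t : lim s -> t ∈ s -> exists r, [/\ r ∈ s, ord r &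
  forall x y, x ∈ vset t -> y ∈ vset t -> pr x y ∈ vset r].
Proof.
move=> ls ts; have [s1 s1s ts1] := lim_succ hL ls ts.
have [s2 s2s s12] := lim_succ hL ls s1s.
have ot := ord_lim_mem ls ts; have os1 := ord_lim_mem ls s1s.
have os2 := ord_lim_mem ls s2s; exists s2; split=> // x y.
exact: (pr_two_up ot os1 os2).
Qed.

(** For x and y in V_s the relation of y to (a . c) x is decided by a small piece
    of c, which is an element of V_s because s is a limit. *)
Lemma agree_appr a a' c s : elementary a -> elementary a' -> elementary c -> lim s ->
  agree s a a' -> agree s (app a c) (app a' c).
Proof.
move=> ea ea' ec ls h x y xs ys; have os := lim_ord ls.
have [t [ts ot xt yt]] := lim_level2 ls xs ys.
have [r [rs o_r hr]] := pr_level_lim ls ts.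
have [q [hq qr]] := ex_trace_on c o_r hr.
have qs : q ∈ vset s by apply: sub_vset qr.
have ps : pr x y ∈ vset s by apply/pr_vset.
have key d : elementary d -> y ∈ app d c x <-> pr x y ∈ d q.
  move=> ed; rewrite (trace_on_pr _ _ (trace_on_app ed ec ot hq)).
  by split=> [?|[]] //; split=> //; apply: vset_infl.
by rewrite !key //; apply: h.
Qed.

Lemma el_cap a x y t : elementary a -> ord t ->
  (forall z, z ∈ y <-> z ∈ x /\ z ∈ vset t) ->
  forall z, z ∈ a y <-> z ∈ a x /\ z ∈ vset (a t).
Proof.
move=> ea ot h.
have d : definable (fun v : nat -> T => forall z, z ∈ v 0 <-> z ∈ v 1 /\ z ∈ v 2).
  by definable_tac.
rewrite -el_vset //.
exact: (el3 (R := fun y x M => forall z, z ∈ y <-> z ∈ x /\ z ∈ M) _ _ _ ea d).1.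
Qed.

(** To decide whether y is in a (b x) it is enough to know b x on a level that
    contains y, and this part of b x is an element of V_s. *)
Lemma agree_comp a a' b b' s : elementary a -> elementary a' -> lim s ->
  agree s a a' -> agree s b b' -> agree s (a \o b) (a' \o b').
Proof.
move=> ea ea' ls ha hb x y xs ys /=; have os := lim_ord ls.
have [t [ts ot yt]] := lim_level ls ys.
pose z := sep (b x) (fun u => u ∈ vset t).
have hz (u : T) : u ∈ z <-> u ∈ b x /\ u ∈ vset t by exact: in_sep.
have hz' (u : T) : u ∈ z <-> u ∈ b' x /\ u ∈ vset t.
  have ut : u ∈ vset t -> u ∈ vset s by apply: vset_mono => //; left.
  by rewrite hz; split=> -[ux /[dup] /ut us]; split=> //; apply/(hb x u xs us).
have zs : z ∈ vset s by apply: (sub_vset ot os ts) => u /hz [].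
have /(_ y) := el_cap ea ot hz; have /(_ y) := el_cap ea' ot hz'.
have h1 := vset_infl ea ot yt; have h2 := vset_infl ea' ot yt.
have := ha z y zs ys; tauto.
Qed.

(** * Critical points *)

Definition fixes a s := forall x, x ∈ s -> a x = x.

Lemma fixes_vset a s x : elementary a -> ord s -> fixes a s -> x ∈ vset s -> a x = x.
Proof.
move=> ea; elim: s / (wf_mem s) x => s _ IH x os fs; rewrite in_vset // => -[b bs hb].
have [t e] := ex_mem_V hL bs; rewrite -e in bs hb; have ot : ord t by apply: ord_mem bs.
have ft : fixes a t by move=> y yt; apply: fs; apply: ord_trans yt bs.
have xt y : y ∈ x -> y ∈ vset t by move=> yx; apply/in_vset => //; apply: hb.
have fx y : y ∈ vset t -> a y = y by apply: IH.
apply: (extV hL) => z; split=> [zx|zx]; last by rewrite -(fx z) -?el_mem //; apply: xt.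
have zt : z ∈ vset t by have := el_sub ea xt zx; rewrite el_vset // fs.
by rewrite -(fx z zt) -el_mem in zx.
Qed.

(** An embedding that fixes all ordinals fixes the levels, hence by induction on
    rank all sets. *)
Lemma ex_crit a : elementary a -> (exists x, a x <> x) -> exists k, is_crit a k.
Proof.
move=> ea [x hx].
have [|k [ok nk hk]] := @ex_least_ord U L (fun k => a k <> k).
  apply: NNPP => h; apply: hx; have [s os xs] := ex_level hL x.
  apply: (fixes_vset ea os) xs => y ys; apply: NNPP => ny; apply: h.
  by exists y => //; apply: ord_mem ys.
exists k; split=> // y yk; apply: NNPP => ny.
by apply: (ole_not_lt (hk y (ord_mem ok yk) ny)).
Qed.

Section Crit.
Context (a : T -> T) (k : T) (ea : elementary a) (hk : is_crit a k).

Lemma crit_ord : ord k. Proof. by case: hk. Qed.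

Lemma crit_fixes : fixes a k. Proof. by case: hk. Qed.

Lemma crit_lt : k ∈ a k.
Proof.
by have [ok nk _] := hk; case: (el_infl hL ea ok) => // /vval_inj e; case: nk.
Qed.

Lemma crit_lim : lim k.
Proof.
have ok := crit_ord; apply/(limV hL); split=> //; split.
  apply: NNPP => h; have [_ nk _] := hk; apply: nk.
  have d : definable (fun v : nat -> T => forall y : T, ~ y ∈ v 0) by definable_tac.
  have h0 (y : T) : ~ y ∈ k by move=> yk; apply: h; exists y.
  have := (el1 (R := fun x => forall y : T, ~ y ∈ x) k ea d).1 h0 => h1.
  by apply: (extV hL) => z; split=> [/h1|/h0].
move=> y yk; apply: NNPP => h; have oy := ord_mem ok yk.
have kE z : z ∈ k <-> z ∈ y \/ z = y.
  split=> [zk|[zy|->]] //; last exact: ord_trans ok zy yk.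
  have [h1|h1|h1] := ord_total (ord_mem ok zk) oy; first by left.
    by right; apply: vval_inj.
  by case: h; exists z.
have d : definable (fun v : nat -> T => forall z : T, z ∈ v 0 <-> z ∈ v 1 \/ z = v 1).
  by definable_tac.
have := (el2 (R := fun k y => forall z, z ∈ k <-> z ∈ y \/ z = y) k y ea d).1 kE.
rewrite (crit_fixes yk) => kE'; have [_ nk _] := hk; apply: nk.
by apply: (extV hL) => z; rewrite kE kE'.
Qed.

Lemma crit_unique k' : is_crit a k' -> k' = k.
Proof.
move=> [ok' nk' fk']; have [ok nk fk] := hk.
have [h|h|h] := ord_total ok ok'; last by case: nk'; apply: fk.
  by case: nk; apply: fk'.
exact: vval_inj.
Qed.

Lemma fixes_crit s : ord s -> fixes a s -> ole s k.
Proof.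
move=> os fs; have [//|h] := ole_or_lt os crit_ord.
by have [_ nk _] := hk; case: nk; apply: fs.
Qed.

End Crit.

Lemma crit_app a b k : elementary a -> elementary b -> is_crit b k ->
  is_crit (app a b) (a k).
Proof.
move=> ea eb [ok nk fk]; split; first exact: ord_el.
  by rewrite app_comm // => /(el_inj ea).
have [r hr] := ex_graph_on hL eb ok.
have d : definable (fun v : nat -> T => forall x, x ∈ v 0 -> pr x x ∈ v 1) by definable_tac.
have h x : x ∈ k -> pr x x ∈ r.
  move=> xk; apply/(graph_on_pr _ _ hr); split; last by rewrite fk.
  by apply/ord_vset => //; apply: ord_mem xk.
have h' := (el2 (R := fun k r => forall x, x ∈ k -> pr x x ∈ r) k r ea d).1 h.
by move=> x /h' /(graph_on_pr _ _ (graph_on_app ea eb ok hr)) [].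
Qed.

Lemma agree_idP a s : elementary a -> lim s -> agree s a id <-> fixes a s.
Proof.
move=> ea ls; have os := lim_ord ls; split=> [h x xs|h x y xs ys]; last first.
  by rewrite (fixes_vset ea os h xs).
have ox : ord x := ord_mem os xs.
case: (el_infl hL ea ox) => [h1|/vval_inj //].
have xv : x ∈ vset s by apply/ord_vset.
by case: (@mem_irr _ x); apply/(h x x xv xv).
Qed.

(** Inside the level, a x is the set of its elements there; agreement therefore
    leaves no room for b x to differ once a x is small. *)
Lemma agree_ord a b s x : elementary a -> elementary b -> lim s -> agree s a b ->
  ord x -> x ∈ s -> a x ∈ s -> b x = a x.
Proof.
move=> ea eb ls h ox xs axs; have os := lim_ord ls.
have xv : x ∈ vset s by apply/ord_vset.
have oa := ord_el ea ox; have ob := ord_el eb ox.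
have av : a x ∈ vset s by apply/ord_vset.
have [h1|e|h1] := ord_total ob oa; last first.
- by case: (@mem_irr _ (a x)); apply/(h x _ xv av).
- exact: vval_inj.
have bv : b x ∈ vset s by apply: vset_trans av h1.
by case: (@mem_irr _ (b x)); apply/(h x _ xv bv).
Qed.

End Congruence.

(** * The iterates of j and the Laver-Steel theorem *)

Section Iterates.
Context (U : zfc_universe) (L : U) (hL : limit_ordinal L).
Notation T := (V L).
Notation pr := (pr hL).
Notation vset := (vset hL).
Notation graph_on := (graph_on hL).
Notation trace_on := (trace_on hL).
Notation app := (app hL).
Notation agree := (agree hL).
Context (j : T -> T) (ej : elementary j) (kappa : T) (hk : is_crit j kappa).
Implicit Types (x y z s t p q r k M : T) (a b c : T -> T).

(** Ordinals below the supremum of the critical sequence of j.  Working below it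
    takes the place of Kunen's theorem, by which there is nothing above. *)
Definition bounded x := exists n, x ∈ iter n j kappa.

Lemma kap_lim n : lim (iter n j kappa).
Proof. by elim: n => [|n IH]; [exact: (crit_lim hL ej hk) | exact: (lim_el hL ej IH)]. Qed.

Lemma kap_ord n : ord (iter n j kappa). Proof. exact: lim_ord (kap_lim n). Qed.

Lemma kap_lt n : iter n j kappa ∈ iter n.+1 j kappa.
Proof.
elim: n => [|n IH]; first exact: (crit_lt hL ej hk).
exact: ((el_mem ej _ _).1 IH).
Qed.

Lemma bounded_kap n : bounded (iter n j kappa). Proof. by exists n.+1; apply: kap_lt. Qed.

Lemma bounded_ole x y : ole x y -> bounded y -> bounded x.
Proof. by move=> h [n yn]; exists n; apply: ole_lt_trans (kap_ord n) h yn. Qed.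

(** The last clause is what elementarity carries from j to all of A; the third one
    keeps images in the range where the last one applies. *)
Definition moving c := [/\ elementary c, exists k, is_crit c k,
  forall x, ord x -> bounded x -> bounded (c x)
  & forall k x, is_crit c k -> ord x -> ole k x -> bounded x -> x ∈ c x].

(** A bounded ordinal between two consecutive terms of the critical sequence is
    moved beyond the second one. *)
Lemma moving_j : moving j.
Proof.
split=> //; first by exists kappa.
  by move=> x ox [n xn]; exists n.+1; rewrite iterS -el_mem.
move=> k x hk'; rewrite (crit_unique hk hk') => ox kx [n].
elim: n => [|n IH] xn; first by case: (ole_not_lt kx).
have [h|/IH //] := ole_or_lt (kap_ord n) ox.
exact: lt_ole_trans (ord_el hL ej ox) xn (el_ole ej h).
Qed.

(** For each term k of the critical sequence, the property that b moves the
    ordinals from its critical point up to k is carried by a to the same property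
    of a . b below a k, and k <= a k. *)
Lemma moving_app a b : moving a -> moving b -> moving (app a b).
Proof.
move=> [ea _ ba _] [eb [k hkb] bb mb].
have eab := app_elementary hL ea eb.
split=> //; first by exists (a k); apply: crit_app.
  move=> x ox bx.
  have : ole (app a b x) (a (b x)).
    by rewrite -(app_comm hL x ea eb); apply: (el_ole eab); apply: el_infl.
  by move/bounded_ole; apply; apply: ba; [exact: ord_el | exact: bb].
move=> k' x hk' ox kx [n xn].
have k'E := crit_unique (crit_app hL ea eb hkb) hk'; rewrite k'E in kx.
have ok := kap_ord n; have [r hr] := ex_graph_on hL eb ok.
pose R k r s := forall x, x ∈ s -> ~ x ∈ k -> exists z, pr x z ∈ r /\ x ∈ z.
have d : definable (fun v : nat -> T => R (v 0) (v 1) (v 2)) by rewrite /R; definable_tac.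
have h : R k r (iter n j kappa).
  move=> y yn nyk; have oy := ord_mem ok yn; exists (b y); split.
    by apply/(graph_on_pr _ _ hr); split=> //; apply/ord_vset.
  apply: (mb k y hkb oy); last by exists n.
  by have [|] := ole_or_lt (crit_ord hkb) oy.
have h' := (el3 _ _ _ ea d).1 h.
have [|//|z [/(graph_on_pr _ _ (graph_on_app ea eb ok hr)) [_ ->] //]] := h' x.
  exact: lt_ole_trans (ord_el hL ea ok) xn (el_infl hL ea ok).
exact: ole_not_lt.
Qed.

(** J 0 stands for the identity, which is congruent to J (2 ^ n) modulo gam n. *)
Fixpoint J n : T -> T := if n is m.+1 then app (J m) j else id.

Lemma id_elementary : elementary (id : T -> T). Proof. by []. Qed.

Lemma app_id a : elementary a -> app id a = a.
Proof.
by move=> ea; apply: functional_extensionality => x; exact: (app_comm hL x id_elementary ea).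
Qed.

Lemma J1 : J 1 = j. Proof. exact: app_id. Qed.

Lemma moving_J n : moving (J n.+1).
Proof.
elim: n => [|n IH]; first by rewrite J1; exact: moving_j.
exact: moving_app moving_j.
Qed.

Lemma J_el n : elementary (J n).
Proof. by case: n => [|n]; [exact: id_elementary | case: (moving_J n)]. Qed.
Hint Resolve J_el : core.

Lemma J_crit n : is_crit (J n.+1) (J n kappa).
Proof. exact: crit_app. Qed.

(** Write P n for p being in J_(n+1) Y, where q is the trace of j on V_s and
    p = (Y, q).  The set Y consists of the pairs (u, r) such that no tuple
    (r, (r, ... (r, (u, (u, r))))) is in q.  Applying J_(n+1) replaces q by the
    trace of J_(n+2), and each further r strips one more j, so the tuple of
    depth i is in J_(n+1) q exactly when P (n + i + 1).  Hence P n means that all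
    later P m fail, for every n, which is impossible: a true P n makes P (n + 1)
    both false and true, and if all fail then P 0 holds. *)
Lemma Laver_Steel s : lim s -> ~ forall n, s ∈ J n.+1 s.
Proof.
move=> ls mv; have os := lim_ord ls.
have [q [hq qs]] : exists q, trace_on j (vset s) q /\ forall p, p ∈ q -> p ∈ vset s.
  by apply: ex_trace_on => // x y xs ys; apply/pr_vset.
(* The set C stands for the family of all tuples, so that no numbers occur. *)
pose Z p q := exists u r : T, p = pr u r /\ exists C : T,
  pr u p ∈ C /\ forall z, z ∈ C -> ~ z ∈ q /\ pr r z ∈ C.
pose Y := sep (vset s) (fun p => Z p q).
pose p := pr Y q.
have Jl n : lim (J n.+1 s) by apply: lim_el.
have Jo n : ord (J n.+1 s) by apply: lim_ord.
have Yn n : Y ∈ vset (J n.+1 s) by apply: (sub_vset os (Jo n) (mv n)) => y /in_sep [].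
have qn n : q ∈ vset (J n.+1 s) by apply: (sub_vset os (Jo n) (mv n)).
have pn n : p ∈ vset (J n.+1 s) by apply/pr_vset.
(* The tuple of depth i with entries q around (Y, p). *)
pose nest i := iter i (pr q) (pr Y p).
have nestV i n : nest i ∈ vset (J n.+1 s).
  by elim: i => [|i IH]; apply/pr_vset.
pose P n := p ∈ J n.+1 Y.
have hqn n : trace_on (J n.+2) (vset (J n.+1 s)) (J n.+1 q).
  exact: (trace_on_app (J_el n.+1) ej os hq).
have nestP i n : nest i ∈ J n.+1 q <-> P (n + i).+1.
  elim: i n => [|i IH] n; rewrite /nest /= (trace_on_pr _ _ (hqn n)).
    by rewrite addn0; split=> [[]|].
  by rewrite -/(nest i) addnS -addSn -IH; split=> [[]|].
have PZ n : P n <-> Z p (J n.+1 q).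
  pose R y M q := forall p, p ∈ y <-> p ∈ M /\ Z p q.
  have d : definable (fun v : nat -> T => R (v 0) (v 1) (v 2)) by rewrite /R /Z; definable_tac.
  have h : R Y (vset s) q by move=> y; apply: in_sep.
  have := (el3 _ _ _ (J_el n.+1) d).1 h p; rewrite /P el_vset // => ->.
  by split=> [[]|].
have PE n : P n <-> forall i, ~ P (n + i).+1.
  rewrite PZ; split.
    move=> [u [b [/pr_inj [<- <-] [C [pC hC]]]]] i; rewrite -nestP.
    suff /hC [] : nest i ∈ C by [].
    by elim: i => [|i /hC [_]].
  move=> h; exists Y, q; split=> //.
  exists (sep (vset (J n.+1 s)) (fun z => exists i, z = nest i)); split.
    by apply/in_sep; split; [exact: (nestV 0) | exists 0].
  move=> z /in_sep [_ [i ->]]; split; first by rewrite nestP.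
  by apply/in_sep; split; [exact: (nestV i.+1) | exists i.+1].
have nP n : ~ P n.
  move=> Pn; have h := (PE n).1 Pn; have := h 0; rewrite addn0; apply.
  by apply/PE => i; rewrite addSnnS; exact: (h i.+1).
by apply: (nP 0); apply/PE => i; apply: nP.
Qed.

(** * The critical sequence of the iterates *)

Definition gam n := J (2 ^ n).-1 kappa.

Lemma pow2S n : (2 ^ n).-1.+1 = 2 ^ n.
Proof. by rewrite prednK // expn_gt0. Qed.

Lemma gam_crit n : is_crit (J (2 ^ n)) (gam n).
Proof. by have := J_crit (2 ^ n).-1; rewrite pow2S. Qed.

Lemma gam_lim n : lim (gam n). Proof. exact: crit_lim (gam_crit n). Qed.

Lemma gam_ord n : ord (gam n). Proof. exact: lim_ord (gam_lim n). Qed.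
Hint Resolve gam_lim gam_ord : core.

Lemma J_bounded n x : ord x -> bounded x -> bounded (J n x).
Proof. by case: n => [|n] // ox bx; have [_ _ h _] := moving_J n; apply: h. Qed.

Lemma gam_bounded n : bounded (gam n).
Proof. by apply: J_bounded; [exact: (kap_ord 0) | exact: (bounded_kap 0)]. Qed.

Lemma agree_JD s m i : lim s -> agree s (J m) id -> agree s (J (m + i)) (J i).
Proof.
move=> ls h; elim: i => [|i IH]; first by rewrite addn0.
by rewrite addnS; apply: agree_appr.
Qed.

Lemma agree_JDr s m m' i : lim s -> agree s (J m) (J m') -> agree s (J (m + i)) (J (m' + i)).
Proof.
move=> ls h; elim: i => [|i IH]; first by rewrite !addn0.
by rewrite !addnS; apply: agree_appr.
Qed.

Lemma J_id n : agree (gam n) (J (2 ^ n)) id.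
Proof. by apply/agree_idP => //; apply: crit_fixes (gam_crit n). Qed.

(** With E = J (2 ^ n) and t the least limit ordinal above gam n, the maps
    J (2 ^ n + i) and E . J_i agree on V_t for 0 < i <= 2 ^ n.  The step from i to
    i + 1 applies both sides to j, and (E . J_i) . j agrees with
    (E . J_i) . (E . j) = E . (J_i . j), because E . j agrees with j below gam n
    and E . J_i moves gam n to a limit ordinal above it.  For i = 2 ^ n, the critical point
    E (gam n) of E . E is at least t. *)
Lemma gam_step n :
  (forall i k, 0 < i < 2 ^ n -> is_crit (J i) k -> k ∈ gam n) -> gam n ∈ gam n.+1.
Proof.
move=> S; pose E := J (2 ^ n); have eE : elementary E by exact: J_el.
have gE : moving E by rewrite /E -pow2S; apply: moving_J.
have mvg c k : moving c -> is_crit c k -> ole k (gam n) -> gam n ∈ c (gam n).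
  by move=> [_ _ _ h] hc le; apply: h hc _ le (gam_bounded n).
(* Minimality of t makes it at most e (gam n) for each e that moves gam n. *)
have [|t [ot [lt gt] tmin]] :=
    @ex_least_ord U L (fun t => lim t /\ gam n ∈ t).
  exists (E (gam n)); first exact: ord_el.
  split; first exact: lim_el.
  exact: (mvg _ _ gE (gam_crit n) (or_intror erefl)).
have tle c k : moving c -> is_crit c k -> ole k (gam n) -> ole t (c (gam n)).
  move=> gc hc le; have [ec _ _ _] := gc.
  apply: tmin; first exact: ord_el.
  by split; [exact: lim_el | exact: (mvg c k)].
have main i : i < 2 ^ n -> agree t (J (2 ^ n + i.+1)) (app E (J i.+1)).
  elim: i => [|i IH] hi; first by rewrite J1 addn1.
  rewrite addnS -[J i.+2]/(app (J i.+1) j) (app_LD hL) //.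
  pose e := app E (J i.+1).
  have [_ [k hki] _ _] := moving_J i.
  have ki : k ∈ gam n by apply: (S i.+1).
  have ee : elementary e by apply: app_elementary.
  have ge : moving e by apply: moving_app => //; apply: moving_J.
  have ce : is_crit e k.
    have fk : E k = k := crit_fixes (gam_crit n) ki.
    by have := crit_app hL eE (J_el i.+1) hki; rewrite fk.
  apply: (agree_trans (b := app e j)); first by apply: agree_appr => //; apply: IH; apply: ltnW.
  have h : agree (gam n) j (app E j).
    by rewrite -{1}(app_id ej); apply: agree_sym; apply: agree_appr => //; apply: J_id.
  have eEj := app_elementary hL eE ej.
  apply: agree_le (agree_appl ee ej eEj (gam_ord n) h) => //; first exact: ord_el.
  by apply: (tle e k) => //; left.
have := main (2 ^ n).-1; rewrite pow2S addnn -mul2n -expnS => /(_ _)/agree_trans h.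
have fE : agree t (app E E) id.
  apply/agree_idP => //; first exact: app_elementary.
  have cEE : is_crit (app E E) (E (gam n)) by apply: crit_app => //; apply: gam_crit.
  move=> x xt; apply: (crit_fixes cEE).
  have := tle E (gam n) gE (gam_crit n) (or_intror erefl).
  by apply: lt_ole_trans xt => //; apply: ord_el.
have : agree t (J (2 ^ n.+1)) id by apply: h fE; exact: leqnn.
move/agree_idP => /(_ (J_el _) lt) fx.
exact: lt_ole_trans (gam_ord _) gt (fixes_crit (gam_crit _) ot fx).
Qed.

Lemma crit_lt_gam n i k : 0 < i < 2 ^ n -> is_crit (J i) k -> k ∈ gam n.
Proof.
elim: n i k => [|n IH] i k; first by case: i => // i; rewrite expn0 ltnS ltn0 andbF.
have gS := gam_step IH; move=> /andP [i0 hi] hki.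
have [lt|lt|e] := ltngtP i (2 ^ n).
- apply: ord_trans (gam_ord n.+1) _ gS.
  by apply: (IH i) => //; rewrite i0.
- have oi := crit_ord hki.
  pose i' := i - 2 ^ n.
  have i'E : i = 2 ^ n + i' by rewrite subnKC // ltnW.
  have [m mE] : exists m, i' = m.+1.
    by exists i'.-1; rewrite prednK // subn_gt0.
  have i'2 : 0 < i' < 2 ^ n.
    by rewrite {1}mE /= /i' ltn_subLR ?(ltnW lt) // addnn -mul2n -expnS.
  have h := @agree_JD (gam n) (2 ^ n) i' (gam_lim n) (@J_id n); rewrite -i'E in h.
  have [h1|h1] := ole_or_lt (gam_ord n) oi; last exact: ord_trans (gam_ord n.+1) h1 gS.
  have [_ [k' hk'] _ _] := moving_J m; rewrite -mE in hk'.
  have k'g := IH _ _ i'2 hk'.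
  have fi : fixes (J i) (gam n).
    by move=> x xg; apply: (crit_fixes hki); apply: lt_ole_trans xg h1.
  have /agree_idP : agree (gam n) (J i') id.
    by apply: agree_trans (agree_sym h) _; apply/agree_idP.
  move=> /(_ (J_el _) (gam_lim n)) fi'.
  by have [_ + _] := hk'; case; apply: fi'.
- by rewrite e in hki; rewrite (crit_unique (gam_crit n) hki).
Qed.

Lemma gam_lt_step n : gam n ∈ gam n.+1.
Proof. by apply: gam_step => i k; apply: crit_lt_gam. Qed.

Lemma gam_mono m n : m < n -> gam m ∈ gam n.
Proof.
elim: n => // n IH; rewrite ltnS leq_eqVlt => /orP [/eqP ->|/IH h].
  exact: gam_lt_step.
exact: ord_trans (gam_ord n.+1) h (gam_lt_step n).
Qed.

Lemma gam_ole m n : m <= n -> ole (gam m) (gam n).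
Proof. by rewrite leq_eqVlt => /orP [/eqP ->|/gam_mono]; [right|left]. Qed.

Lemma gam_lt_inv m n : gam m ∈ gam n -> m < n.
Proof.
by move=> h; rewrite ltnNge; apply/negP => /gam_ole /ole_not_lt.
Qed.

(** Otherwise some term of the critical sequence of j would bound all critical
    points of the iterates, hence be moved by all of them. *)
Lemma gam_cofinal x : ord x -> bounded x -> exists n, x ∈ gam n.
Proof.
move=> ox [m xm]; apply: NNPP => h; apply: (Laver_Steel (kap_lim m)) => i.
have [_ [k hki] _ mv] := moving_J i; apply: (mv k) => //; first exact: kap_ord.
  left; have i2 : 0 < i.+1 < 2 ^ i.+1 by rewrite /= ltn_expl.
  have kg := crit_lt_gam i2 hki; apply: ord_trans (kap_ord m) kg _.
  have [gx|xg] := ole_or_lt (gam_ord i.+1) ox; last by case: h; exists i.+1.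
  exact: ole_lt_trans (kap_ord m) gx xm.
exact: bounded_kap.
Qed.

(** * Reduction of the algebra modulo a critical point *)

Lemma J_mod n i : agree (gam n) (J i) (J (i %% 2 ^ n)).
Proof.
rewrite {1}(divn_eq i (2 ^ n)); elim: (i %/ 2 ^ n) => [|q IH]; first by rewrite mul0n.
rewrite mulSn -addnA; apply: agree_trans IH.
by apply: agree_JD => //; apply: J_id.
Qed.

Lemma J_rep n i : exists2 i', 0 < i' <= 2 ^ n & agree (gam n) (J i) (J i').
Proof.
have h := @J_mod n i; have lt : i %% 2 ^ n < 2 ^ n by rewrite ltn_mod expn_gt0.
have [e|ne] := posnP (i %% 2 ^ n); last first.
  by exists (i %% 2 ^ n) => //; rewrite ne ltnW.
exists (2 ^ n); first by rewrite expn_gt0 leqnn.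
by rewrite e in h; apply: agree_trans h _; apply: agree_sym; apply: J_id.
Qed.

Lemma J_not_id n i : 0 < i < 2 ^ n -> ~ agree (gam n) (J i) id.
Proof.
case: i => // i hi /agree_idP h.
by have [_ + _] := J_crit i; case; apply: h => //; apply: crit_lt_gam hi (J_crit i).
Qed.

(** If J_i and J_k agree with i < k, appending 2 ^ n - k factors j to both gives an
    index strictly between 0 and 2 ^ n whose iterate acts as the identity. *)
Lemma J_inj (n i k : nat) : i < 2 ^ n -> k < 2 ^ n -> agree (gam n) (J i) (J k) -> i = k.
Proof.
wlog lt : i k / i < k.
  move=> W hi hk' h; have [lt|lt|//] := ltngtP i k; first exact: W.
  by apply/esym/W => //; apply: agree_sym.
move=> hi hk' h; have le := ltnW hk'.
have h2 := @agree_JDr (gam n) i k (2 ^ n - k) (gam_lim n) h.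
rewrite subnKC // in h2.
case: (@J_not_id n (i + (2 ^ n - k))); last exact: agree_trans h2 (@J_id n).
rewrite addn_gt0 subn_gt0 hk' orbT /=.
by rewrite -{2}(subnKC le) ltn_add2r.
Qed.

(** The usual computation of the finite algebras, by downward induction on i: the
    product with k + 1 is the product of i' > i with i + 1. *)
Lemma J_app (n i k : nat) : i < 2 ^ n -> 0 < k ->
  exists2 i', i < i' <= 2 ^ n & agree (gam n) (app (J i) (J k)) (J i').
Proof.
have [d] := ubnP (2 ^ n - i); elim: d i k => // d IHd i k hd hi.
elim: k => // k IHk _; have [->|k0] := posnP k.
  by exists i.+1; [rewrite ltnSn | rewrite J1].
have [i' /andP [ii' i'n] h] := IHk k0.
rewrite [J k.+1]/= (app_LD hL) // -[app (J i) j]/(J i.+1).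
have h2 : agree (gam n) (app (app (J i) (J k)) (J i.+1)) (app (J i') (J i.+1)).
  by apply: agree_appr => //; apply: app_elementary.
have [e|ne] := eqVneq i' (2 ^ n).
  exists i.+1; first by rewrite ltnSn.
  rewrite e in h2; apply: agree_trans h2 _.
  rewrite -{2}(app_id (J_el i.+1)); apply: agree_appr => //; exact: J_id.
have i'lt : i' < 2 ^ n by rewrite ltn_neqAle ne.
have [||//|i'' /andP [h1 h3] h4] := IHd i' i.+1.
- by move: hd ii' i'n; clear; lia.
- by [].
exists i''; first by rewrite h3 (ltn_trans ii' h1).
exact: agree_trans h2 h4.
Qed.

(** Since J_i o J_k = (J_i . J_k) o J_i, downward induction on i applies. *)
Lemma J_comp (n i k : nat) : exists c : nat, agree (gam n) (J i \o J k) (J c).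
Proof.
have [i' /andP [_ hi'] h] := J_rep n i.
suff [c hc] : exists c : nat, agree (gam n) (J i' \o J k) (J c).
  by exists c; apply: agree_trans hc; apply: agree_comp.
have [k' /andP [k0 _] hk'] := J_rep n k.
suff [c hc] : exists c : nat, agree (gam n) (J i' \o J k') (J c).
  by exists c; apply: agree_trans hc; apply: agree_comp.
move: hi' k0; clear h hk' i k; have [d] := ubnP (2 ^ n - i').
elim: d i' k' => // d IH i k hd hi k0.
have [->|ne] := eqVneq i (2 ^ n).
  exists k; have h := @agree_refl _ _ hL (gam n) (J k).
  exact: (agree_comp (J_el _) id_elementary (gam_lim n) (@J_id n) h).
have lt : i < 2 ^ n by rewrite ltn_neqAle ne.
have [->|i0] := posnP i; first by exists k.
have [i' /andP [ii' i'n] h] := J_app lt k0.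
have [||//|c hc] := IH i' i; first by move: hd ii' i'n; clear; lia.
- by [].
exists c; rewrite (comp_app hL) //; apply: agree_trans hc.
by apply: agree_comp => //; apply: app_elementary.
Qed.

(** Membership in P enters the argument only through this property. *)
Definition tame u := elementary u /\ forall n, exists i, agree (gam n) u (J i).

Lemma tame_J i : tame (J i).
Proof. by split=> // n; exists i. Qed.

Lemma tame_app a b : tame a -> tame b -> tame (app a b).
Proof.
move=> [ea ha] [eb hb]; split; first exact: app_elementary.
move=> n; have [i hi] := ha n; have [k hk'] := hb n.
have [k' /andP [k0 _] hk2] := J_rep n k.
have hi2 := agree_trans hi (@J_mod n i).
have lt : i %% 2 ^ n < 2 ^ n by rewrite ltn_mod expn_gt0.
have [c _ hc] := J_app lt k0; exists c; apply: agree_trans hc.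
apply: agree_trans (agree_appr ea (J_el _) eb (gam_lim n) hi2) _.
have h := agree_appl (J_el (i %% 2 ^ n)) eb (J_el k') (gam_ord n) (agree_trans hk' hk2).
apply: agree_le h => //; [exact: ord_el | exact: el_infl].
Qed.

Lemma tame_comp a b : tame a -> tame b -> tame (a \o b).
Proof.
move=> [ea ha] [eb hb]; split; first exact: comp_elementary.
move=> n; have [i hi] := ha n; have [k hk'] := hb n.
have [c hc] := J_comp n i k; exists c; apply: agree_trans hc.
exact: agree_comp.
Qed.

Lemma calP_tame u : calP j u -> tame u.
Proof.
elim=> [|a b c _ ta _ tb hc|a b _ ta _ tb]; last exact: tame_comp.
  by rewrite -J1; apply: tame_J.
have [[ea _] [eb _]] := (ta, tb).
by rewrite (app_unique hL ea eb hc); apply: tame_app.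
Qed.

Lemma calA_calP u : calA j u -> calP j u.
Proof.
elim=> [|a b c _ ha _ hb hc]; first exact: calP_gen.
exact: calP_app ha hb hc.
Qed.

Lemma calA_tame u : calA j u -> tame u.
Proof. by move/calA_calP/calP_tame. Qed.

Lemma calA_moving u : calA j u -> moving u.
Proof.
elim=> [|a b c _ ga _ gb hc]; first exact: moving_j.
have [[ea _ _ _] [eb _ _ _]] := (ga, gb).
by rewrite (app_unique hL ea eb hc); apply: moving_app.
Qed.

Lemma calA_calA a b : calA j a -> calA j b -> calA j (app a b).
Proof.
move=> ha hb; apply: (calA_app ha hb).
by have [[ea _] [eb _]] := (calA_tame ha, calA_tame hb); apply: is_app_app.
Qed.

Lemma calA_J i : calA j (J i.+1).
Proof.
elim: i => [|i IH]; first by rewrite J1; apply: calA_gen.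
by apply: calA_calA => //; apply: calA_gen.
Qed.

Lemma crit_agree a b k s : elementary a -> elementary b -> lim s -> k ∈ s ->
  agree s a b -> is_crit a k -> is_crit b k.
Proof.
move=> ea eb ls ks h hka; have [ok nk fk] := hka; split=> // [e|].
  by case: nk; rewrite (agree_ord eb ea ls (agree_sym h) ok ks) e.
suff h3 : agree k b id by exact: ((agree_idP hL eb (crit_lim hL ea hka)).1 h3).
have h2 : agree k b a.
  by apply: agree_sym; apply: agree_le h => //; [exact: lim_ord | left].
by apply: agree_trans h2 _; apply/agree_idP => //; apply: crit_lim hka.
Qed.

(** Modulo gam (v + 1), the iterate J_b agrees with J (2 ^ v), for 2 ^ v the
    largest power of 2 dividing b. *)
Lemma crit_J (b : nat) : 0 < b -> exists2 v, is_crit (J b) (gam v) & 2 ^ v <= b.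
Proof.
move=> b0; pose v := logn 2 b; have vb : 2 ^ v %| b by apply: pfactor_dvdnn.
exists v; last exact: dvdn_leq.
apply: (crit_agree (a := J (2 ^ v)) (s := gam v.+1)) => //.
- exact: gam_lt_step.
- have h := @J_mod v.+1 b.
  suff e : b %% 2 ^ v.+1 = 2 ^ v by rewrite e in h; apply: agree_sym.
  have nv : ~~ (2 ^ v.+1 %| b) by rewrite pfactor_dvdn // ltnn.
  case/dvdnP: vb nv => m ->; rewrite expnS -muln_modl dvdn_pmul2r ?expn_gt0 //.
  by rewrite dvdn2 negbK modn2 => ->; rewrite mul1n.
- exact: gam_crit.
Qed.

Lemma crit_tame a k : tame a -> is_crit a k -> bounded k -> exists v, k = gam v.
Proof.
move=> [ea ha] hka bk; have [n kn] := gam_cofinal (crit_ord hka) bk.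
have [i hi] := ha n; have hki := crit_agree ea (J_el i) (gam_lim n) kn hi hka.
case: i hi hki => [|i] hi hki; first by have [_ +] := hki; case.
have [v hv _] := crit_J (ltn0Sn i); exists v; exact: (crit_unique hv hki).
Qed.

Lemma J_gam i m : exists s : nat, J i (gam m) = gam s.
Proof.
apply: (crit_tame (a := app (J i) (J (2 ^ m)))).
- by apply: tame_app; apply: tame_J.
- by apply: crit_app => //; apply: gam_crit.
- by apply: J_bounded => //; apply: gam_bounded.
Qed.

(** * The finite algebras *)

Lemma ex_op (n a b : nat) : exists c : nat, c < 2 ^ n /\ agree (gam n) (app (J a) (J b)) (J c).
Proof.
have [_ /(_ n) [c hc]] := tame_app (tame_J a) (tame_J b).
exists (c %% 2 ^ n); split; first by rewrite ltn_mod expn_gt0.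
exact: agree_trans hc (@J_mod n c).
Qed.

Definition op (n a b : nat) : nat :=
  proj1_sig (constructive_indefinite_description _ (ex_op n a b)).

Lemma op_lt (n a b : nat) : op n a b < 2 ^ n.
Proof.
by case: (proj2_sig (constructive_indefinite_description _ (ex_op n a b))).
Qed.

Lemma opE (n a b : nat) : agree (gam n) (app (J a) (J b)) (J (op n a b)).
Proof.
by case: (proj2_sig (constructive_indefinite_description _ (ex_op n a b))).
Qed.

Lemma op_uniq (n a b c : nat) : c < 2 ^ n -> agree (gam n) (app (J a) (J b)) (J c) ->
  op n a b = c.
Proof.
move=> hc h; apply: (J_inj (op_lt n a b) hc).
exact: agree_trans (agree_sym (@opE n a b)) h.
Qed.

Lemma agree_app n a a' b b' : elementary a -> elementary a' -> elementary b ->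
  elementary b' -> agree (gam n) a a' -> agree (gam n) b b' ->
  agree (gam n) (app a b) (app a' b').
Proof.
move=> ea ea' eb eb' ha hb; apply: agree_trans (agree_appr ea ea' eb (gam_lim n) ha) _.
apply: agree_le (agree_appl ea' eb eb' (gam_ord n) hb) => //; first exact: ord_el.
exact: el_infl.
Qed.

Lemma op_laver n : laver_table n (op n).
Proof.
split=> [a b|a b|a b c|a]; first exact: op_lt.
- apply: op_uniq; first exact: op_lt.
  apply: agree_trans (@opE n _ _).
  by apply: agree_app => //; apply: J_mod.
- apply: op_uniq; first exact: op_lt.
  have ebc := app_elementary hL (J_el b) (J_el c).
  have eab := app_elementary hL (J_el a) (J_el b).
  have eac := app_elementary hL (J_el a) (J_el c).
  apply: (agree_trans (b := app (J a) (app (J b) (J c)))).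
    by apply: agree_app => //; apply: agree_sym; apply: opE.
  rewrite (app_LD hL) //; apply: agree_trans (@opE n _ _).
  by apply: agree_app => //; apply: opE.
- apply: op_uniq; first by rewrite ltn_mod expn_gt0.
  by rewrite J1; apply: (@J_mod n a.+1).
Qed.

Lemma op_eq0 (n a b v : nat) : is_crit (J b) (gam v) ->
  op n a b = 0 <-> ole (gam n) (J a (gam v)).
Proof.
move=> hb; have hc := crit_app hL (J_el a) (J_el b) hb.
have eab := app_elementary hL (J_el a) (J_el b).
have E : agree (gam n) (app (J a) (J b)) id <-> ole (gam n) (J a (gam v)).
  rewrite agree_idP //; split=> [|h x xn]; first exact: fixes_crit.
  apply: (crit_fixes hc); apply: lt_ole_trans xn h; exact: ord_el.
rewrite -E; split=> [e|h]; first by have := @opE n a b; rewrite e.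
by apply: op_uniq; rewrite ?expn_gt0.
Qed.

Lemma op_gt (n a b : nat) : a < 2 ^ n -> 0 < b -> op n a b != 0 -> a < op n a b.
Proof.
move=> ha b0 ne; have [i /andP [ai iN] h] := J_app ha b0.
have [e|nei] := eqVneq i (2 ^ n).
  have h2 : agree (gam n) (app (J a) (J b)) (J 0).
    by rewrite e in h; apply: agree_trans h (@J_id n).
  by rewrite (op_uniq _ h2) ?expn_gt0 ?eqxx // in ne.
by rewrite (op_uniq _ h) // ltn_neqAle nei.
Qed.

Lemma ex_reach (n a : nat) : exists m, [/\ m <= n, ole (gam n) (J a (gam m))
  & forall m', m' < m -> J a (gam m') ∈ gam n].
Proof.
have top : ole (gam n) (J a (gam n)) by apply: el_infl.
suff main : forall d, (forall m', m' < n - d -> J a (gam m') ∈ gam n) ->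
    exists m, [/\ m <= n, ole (gam n) (J a (gam m))
      & forall m', m' < m -> J a (gam m') ∈ gam n].
  by apply: (main n); rewrite subnn.
elim=> [|d IH] h; first by exists n; split=> //; rewrite subn0 in h.
have [h1|h1] := ole_or_lt (gam_ord n) (ord_el hL (J_el a) (gam_ord (n - d.+1))).
  by exists (n - d.+1); split=> //; apply: leq_subr.
apply: IH => m'; have [le|lt] := leqP n d.
  by move: le; rewrite -subn_eq0 => /eqP ->.
by rewrite -subSS subSn // ltnS leq_eqVlt => /orP [/eqP ->|/h].
Qed.

Lemma reach_period (n a m : nat) : ole (gam n) (J a (gam m)) ->
  (forall m', m' < m -> J a (gam m') ∈ gam n) -> is_period (op n) a (2 ^ m).
Proof.
move=> h1 h2; split.
  by rewrite expn_gt0 /=; apply/eqP/(op_eq0 _ _ (gam_crit m)).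
move=> b /andP [b0 /eqP]; have [v hv vb] := crit_J b0.
move/(op_eq0 n a hv) => h3; apply: leq_trans vb; rewrite leq_exp2l //.
by rewrite leqNgt; apply/negP => /h2; apply: ole_not_lt.
Qed.

(** * Suprema of images *)

Lemma ole_V x y : ole x y <-> x ∈ y \/ x = y.
Proof. by split=> -[h|h]; [left|right; apply: vval_inj|left|right; rewrite h]. Qed.

Lemma ex_sup a s : elementary a -> ord s -> exists t, is_sup_image a s t.
Proof.
move=> ea os.
have [|t [ot ht mt]] :=
    @ex_least_ord U L (fun t => forall x, x ∈ s -> ole (a x) t).
  by exists (a s) => [|x xs]; [exact: ord_el | left; rewrite -el_mem].
by exists t; split.
Qed.

Lemma sup_mem a s t x : elementary a -> ord s -> is_sup_image a s t -> x ∈ t ->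
  exists2 y : T, y ∈ s & ole x (a y).
Proof.
move=> ea os [ot _ mt] xt; apply: NNPP => h; have ox : ord x := ord_mem ot xt.
apply: (ole_not_lt (mt x ox _) xt) => y ys.
have [//|h1] := ole_or_lt (ord_el hL ea (ord_mem os ys)) ox.
by case: h; exists y => //; left.
Qed.

Lemma sup_lt a s t x : elementary a -> lim s -> is_sup_image a s t -> x ∈ s ->
  a x ∈ t.
Proof.
move=> ea ls [ot ht _] xs; have [y ys xy] := lim_succ hL ls xs.
by apply: lt_ole_trans ot _ (ht y ys); rewrite -el_mem.
Qed.

Lemma sup_unique a s t t' : is_sup_image a s t -> is_sup_image a s t' -> t = t'.
Proof.
move=> [ot ht mt] [ot' ht' mt'].
by apply: vval_inj; apply: ole_anti; [exact: mt | exact: mt'].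
Qed.

Lemma sup_id s : lim s -> is_sup_image id s s.
Proof.
move=> ls; have os := lim_ord ls; split=> // [x xs|t ot h]; first by left.
apply: ole_sub => // u us; have [x e] := ex_mem_V hL us; rewrite -e in us *.
have [y ys xy] := lim_succ hL ls us.
exact: lt_ole_trans ot xy (h y ys).
Qed.

(** Being a supremum of the image of s is a first-order property of the
    restriction of b to V_s. *)
Lemma sup_app a b s t : elementary a -> elementary b -> ord s ->
  is_sup_image b s t -> is_sup_image (app a b) (a s) (a t).
Proof.
move=> ea eb os [ot ht mt]; have [r hr] := ex_graph_on hL eb os.
have oat := ord_el hL ea ot; have oas := ord_el hL ea os.
have hr' := graph_on_app ea eb os hr.
pose B r s t := forall x, x ∈ s -> exists y, pr x y ∈ r /\ (y ∈ t \/ y = t).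
pose R r s t := B r s t /\ forall t', ord t' -> B r s t' -> t ∈ t' \/ t = t'.
have BE c M r' s' t' : graph_on c M r' -> (forall x, x ∈ s' -> x ∈ M) ->
    (forall x, x ∈ s' -> ole (c x) t') <-> B r' s' t'.
  move=> hc sM; split=> h x xs; have := h x xs.
    move/ole_V => h1; exists (c x); split=> //.
    by apply/(graph_on_pr _ _ hc); split=> //; apply: sM.
  by move=> [y [/(graph_on_pr _ _ hc) [_ ->] h1]]; apply/ole_V.
have sv x : x ∈ s -> x ∈ vset s.
  by move=> xs; apply/ord_vset => //; apply: ord_mem xs.
have asv x : x ∈ a s -> x ∈ vset (a s).
  by move=> xs; apply/ord_vset => //; apply: ord_mem xs.
have d : definable (fun v : nat -> T => R (v 0) (v 1) (v 2)) by rewrite /R /B; definable_tac.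
have h : R r s t.
  split; first by apply/(BE b _ _ _ _ hr).
  by move=> t' ot' /(BE b _ _ _ _ hr sv) h; apply/ole_V/mt.
have [h1 h2] := (el3 _ _ _ ea d).1 h.
split=> //; first by apply/(BE _ _ _ _ _ hr').
by move=> t' ot' /(BE _ _ _ _ _ hr' asv) h3; apply/ole_V/h2.
Qed.

Lemma sup_agree a b s t p : elementary a -> elementary b -> lim p -> agree p a b ->
  s ∈ p -> a s ∈ p -> is_sup_image a s t -> is_sup_image b s t.
Proof.
move=> ea eb lp h sp asp [ot ht mt]; have op := lim_ord lp.
have os : ord s := ord_mem op sp.
have E x : x ∈ s -> b x = a x.
  move=> xs; apply: (agree_ord ea eb lp h (ord_mem os xs)).
    exact: ord_trans op xs sp.
  by apply: ord_trans op _ asp; rewrite -el_mem.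
split=> // [x xs|t' ot' h']; first by rewrite E //; apply: ht.
by apply: mt => // x xs; rewrite -E //; apply: h'.
Qed.

(** A critical point is regular: g would fix every x < s and every value
    b x < k, hence could not move the supremum k of these values. *)
Lemma sup_lt_crit b g k s t : elementary b -> elementary g -> is_crit g k ->
  s ∈ k -> b s = k -> is_sup_image b s t -> t ∈ k.
Proof.
move=> eb eg hg sk bs ht; have ok := crit_ord hg; have os : ord s := ord_mem ok sk.
have [ot ub mt] := ht.
have le : ole t k.
  by apply: mt => // x xs; left; rewrite -bs -el_mem.
case: le => // /vval_inj tk; rewrite tk in ht.
have [r hr] := ex_graph_on hL eb os.
pose R r s k := forall y, y ∈ k -> exists x, x ∈ s /\ exists z, pr x z ∈ r /\
  (y ∈ z \/ y = z).
have d : definable (fun v : nat -> T => R (v 0) (v 1) (v 2)) by rewrite /R; definable_tac.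
have sv x : x ∈ s -> x ∈ vset s.
  by move=> xs; apply/ord_vset => //; apply: ord_mem xs.
have h : R r s k.
  move=> y yk; have [x xs yx] := sup_mem eb os ht yk; exists x; split=> //.
  by exists (b x); split; [apply/(graph_on_pr _ _ hr); split=> //; apply: sv | apply/ole_V].
have [x [xs [z [xz yz]]]] := (el3 _ _ _ eg d).1 h k (crit_lt hL eg hg).
have fg := crit_fixes hg; rewrite (fg s sk) in xs.
have bxk : b x ∈ k by rewrite -bs -el_mem.
have xk := ord_trans ok xs sk.
have xr : pr x (b x) ∈ g r.
  rewrite -{1}(fg x xk) -{1}(fg _ bxk) -el_prmem //.
  by apply/(graph_on_pr _ _ hr); split=> //; apply: sv.
have [_ /(_ x)] := el_fun eg (graph_on_fun hr).
rewrite el_vset // (fg s sk) => /(_ (sv _ xs)) [w _ u].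
have zE : z = b x by rewrite (u _ xz) (u _ xr).
rewrite zE in yz; move/ole_V: yz => yz.
by case: (ole_not_lt yz bxk).
Qed.

(** * Consequences of the threshold hypothesis *)

Lemma gam_not_lt n x : ord x -> ~ x ∈ gam n -> ole (gam n) x.
Proof. by move=> ox h; have [|] := ole_or_lt (gam_ord n) ox. Qed.

Lemma agree_gam_ge n m a b x : elementary a -> elementary b -> agree (gam n) a b ->
  m <= n -> ord x -> ole (gam m) (a x) -> ole (gam m) (b x).
Proof.
move=> ea eb h mn ox le; apply: gam_not_lt; first exact: ord_el.
move=> lt; have gmn := gam_ole mn.
have bn : b x ∈ gam n := lt_ole_trans (gam_ord n) lt gmn.
have xn : x ∈ gam n := ole_lt_trans (gam_ord n) (el_infl hL eb ox) bn.
have e := agree_ord eb ea (gam_lim n) (agree_sym h) ox xn bn.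
by rewrite e in le; exact: (ole_not_lt le lt).
Qed.

Lemma J_moves i x k : is_crit (J i) k -> ord x -> bounded x -> ole k x -> x ∈ J i x.
Proof.
case: i => [|i] hc ox bx kx; first by have [_ +] := hc; case.
by have [_ _ _ h] := moving_J i; apply: h hc ox kx bx.
Qed.

Lemma J_top (k : nat) : J (2 ^ k).-1 (gam 0) = gam k. Proof. by []. Qed.

Lemma J_gam_lt (b m k : nat) : 0 < b < 2 ^ k -> J b (gam m) = gam k -> m < k.
Proof.
move=> /andP [b0 bk] e; rewrite ltnNge; apply/negP => km.
have [v hv _] := crit_J b0.
have vk : gam v ∈ gam k by apply: (crit_lt_gam (i := b)); rewrite ?b0.
have : gam m ∈ J b (gam m).
  apply: (J_moves hv) => //; first exact: gam_bounded.
  by left; exact: (lt_ole_trans (gam_ord m) vk (gam_ole km)).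
by rewrite e => /gam_lt_inv; rewrite ltnNge km.
Qed.

Lemma op_neq0 (n a b k : nat) : 0 < b < 2 ^ k ->
  (forall m, m < k -> J a (gam m) ∈ gam n) -> op n a b != 0.
Proof.
move=> /andP [b0 bk] h; apply/eqP; have [v hv vb] := crit_J b0.
move/(op_eq0 n a hv)/ole_not_lt; apply; apply: h.
by rewrite -(ltn_exp2l v k (isT : 1 < 2)) (leq_ltn_trans vb).
Qed.

(** With c + 1 the threshold of a, b = c: the hypothesis doubles the period of c
    from A_k to A_(k+1), which says that the least gam m sent by J_c to at least
    gam k is sent below gam (k + 1), hence to gam k.  If no entry of the row of a
    reaches 2 ^ N, take b = 2 ^ k - 1, which sends gam 0 to gam k. *)
Lemma threshold_step (hTH : threshold_hypothesis) N (a k : nat) : 0 < a < 2 ^ N ->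
  ole (gam N.+1) (J a (gam k)) -> (forall m, m < k -> J a (gam m) ∈ gam N) ->
  exists b m : nat, [/\ 0 < b < 2 ^ k, J b (gam m) = gam k & op N.+1 a b < 2 ^ N].
Proof.
move=> /andP [a0 aN] hk1 hk2.
have N2 : 2 ^ N.+1 = 2 ^ N + 2 ^ N by rewrite expnS mul2n addnn.
have op1 n : op n a 1 = a.+1 %% 2 ^ n by have [_ _ _ ->] := op_laver n.
have k0 : 0 < k.
  case: k hk1 hk2 => // hk1 _.
  have := (op_eq0 N.+1 a (gam_crit 0)).2 hk1; rewrite expn0 op1 modn_small //.
  by rewrite N2; move: aN a0; clear; lia.
have hk3 m : m < k -> J a (gam m) ∈ gam N.+1.
  by move/hk2 => h; apply: ord_trans (gam_ord _) h (gam_lt_step N).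
(* For a + 1 = 2 ^ N the map J_a would send gam 0 to gam N, whereas 0 < k. *)
have aN' : a.+1 < 2 ^ N.
  rewrite ltn_neqAle aN andbT; apply/eqP => e.
  have := op1 N; rewrite e modnn => /(op_eq0 N a (gam_crit 0)) /ole_not_lt.
  by apply; apply: hk2.
pose big (n : nat) := (0 < n) && (2 ^ N <= op N.+1 a n).
have [tE|nt] := classic (exists n : nat, big n); last first.
  have k2 : 1 < 2 ^ k by rewrite -{1}(expn0 2) ltn_exp2l.
  exists (2 ^ k).-1, 0; split; [by move: k2; clear; lia | exact: J_top |].
  rewrite ltnNge; apply/negP => h; apply: nt; exists (2 ^ k).-1.
  by rewrite /big h andbT; move: k2; clear; lia.
have [[|c] // /andP [_ hc] cmin] := ex_minnP tE.
have c0 : 0 < c.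
  rewrite lt0n; apply/eqP => e; move: hc; rewrite e op1 modn_small.
    by rewrite leqNgt aN'.
  by rewrite N2; move: aN'; clear; lia.
have cN : op N.+1 a c < 2 ^ N.
  by rewrite ltnNge; apply/negP => h; have := cmin c; rewrite /big c0 h ltnn => /(_ isT).
(* Rows have period 2 ^ k, so the threshold is attained within the first period. *)
have ck : c < 2 ^ k.
  rewrite ltnNge; apply/negP => kc.
  have pk : 0 < 2 ^ k by rewrite expn_gt0.
  pose e := c.+1 - 2 ^ k.
  have eE : c.+1 = 2 ^ k + e by rewrite /e; move: kc; clear; lia.
  have h : agree (gam k) (J c.+1) (J e) by rewrite eE; apply: agree_JD => //; apply: J_id.
  have h2 : agree (gam N.+1) (app (J a) (J c.+1)) (app (J a) (J e)).
    apply: agree_le (agree_appl (J_el a) (J_el c.+1) (J_el e) (gam_ord k) h) => //.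
    exact: ord_el.
  have oe : op N.+1 a c.+1 = op N.+1 a e.
    by apply: op_uniq (op_lt _ _ _) _; apply: agree_trans h2 _; apply: opE.
  have := cmin e; rewrite /big -oe hc andbT => /(_ _).
  have e0 : 0 < e by rewrite /e; move: kc; clear; lia.
  move/(_ e0); rewrite eE; move: pk; clear; lia.
have [m [mk h1 h2]] := ex_reach k c; have [m' [mk' h1' h2']] := ex_reach k.+1 c.
have a2 : a < 2 ^ N.+1 - 1 by rewrite N2; move: aN'; clear; lia.
have := hTH op op_laver N.+1 a k c isT a2 (reach_period hk1 hk3).
have thr : is_threshold N.+1 (op N.+1) a c.+1 by split=> [|q hq]; [rewrite hc | apply: cmin].
move/(_ thr _ _ (reach_period h1 h2) (reach_period h1' h2')).
rewrite -expnS => /eqP; rewrite eqn_exp2l // => /eqP m'E.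
have h3 : J c (gam m) ∈ gam k.+1 by apply: h2'; rewrite m'E.
have [s sE] := J_gam c m; rewrite sE in h1 h3.
exists c, m; split=> //; first by rewrite c0.
have := gam_lt_inv h3; rewrite ltnS sE leq_eqVlt => /orP [/eqP -> //|/gam_mono h4].
by case: (ole_not_lt h1).
Qed.

(** By downward induction on a.  For b from threshold_step and D = J_a . J_b, the
    ordinal J_a t is the supremum of D[gam s] with gam s = J_a (gam m), and
    D (gam s) = J_a (gam k) >= gam (N + 1).  Either D already sends some
    gam r < gam s to at least gam N, or gam s is the least one that it sends so
    far, and then induction yields an ordinal below gam s that D sends to at
    least gam N. *)
Lemma below_period (hTH : threshold_hypothesis) N (a k : nat) : 0 < a < 2 ^ N ->
  ole (gam N.+1) (J a (gam k)) -> (forall m, m < k -> J a (gam m) ∈ gam N) ->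
  exists (b m : nat) (t : T), [/\ is_sup_image (J b) (gam m) t, t ∈ gam k & ole (gam N) (J a t)].
Proof.
have [d] := ubnP (2 ^ N - a); elim: d a k => // d IH a k hd haN hk1 hk2.
have /andP [a0 aN] := haN.
have [b [m [hb bE dN]]] := threshold_step hTH haN hk1 hk2.
have mk := J_gam_lt hb bE.
have [t ht] := ex_sup (J_el b) (gam_ord m).
have tk := sup_lt_crit (J_el b) (J_el _) (gam_crit k) (gam_mono mk) bE ht.
exists b, m, t; split=> //; apply: gam_not_lt.
  exact: (ord_el hL (J_el a) (ord_mem (gam_ord k) tk)).
have eD := app_elementary hL (J_el a) (J_el b).
have [s sE] := J_gam a m.
have := sup_app (J_el a) (J_el b) (gam_ord m) ht; rewrite sE => hs at_lt.
have [_ ub _] := hs.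
have DE : app (J a) (J b) (gam s) = J a (gam k) by rewrite -sE (app_comm hL) // bE.
(* The index of D modulo gam (N + 1) lies strictly between a and 2 ^ N. *)
have ne : op N.+1 a b != 0.
  apply: (op_neq0 hb) => m' /hk2 h; exact: ord_trans (gam_ord _) h (gam_lt_step N).
set e := op N.+1 a b in dN ne *.
have hD : agree (gam N.+1) (app (J a) (J b)) (J e) := @opE N.+1 a b.
have ae : a < e.
  apply: op_gt ne; first by apply: ltn_trans aN _; rewrite ltn_exp2l.
  by case/andP: hb.
have es : ole (gam N.+1) (J e (gam s)).
  by apply: (agree_gam_ge eD (J_el e) hD (leqnn _)) => //; rewrite DE.
have no x : x ∈ gam s -> ord x -> ole (gam N) (J e x) -> False.
  move=> xs ox h.
  have := agree_gam_ge (J_el e) eD (agree_sym hD) (leqnSn N) ox h => h1.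
  apply: (ole_not_lt h1); exact: ole_lt_trans (gam_ord N) (ub x xs) at_lt.
have [r [rN h1 h2]] := ex_reach N e.
have [rs|sr|rs] := ltngtP r s.
- exact: (no _ (gam_mono rs)).
- have h3 := h2 _ sr.
  have h4 := ole_lt_trans (gam_ord _) es (ord_trans (gam_ord N.+1) h3 (gam_lt_step N)).
  exact: (mem_irr h4).
rewrite rs in h2.
have [||b' [m' [t' [ht' tk' h3]]]] := IH e s _ _ es h2.
- by move: hd ae dN; clear; lia.
- by rewrite dN andbT (leq_trans _ ae).
exact: (no t' tk' (ord_mem (gam_ord s) tk') h3).
Qed.

(** * Least preimages *)

(** All of Sigma has this form, since members of P are congruent to iterates. *)
Definition gam_sup t := exists i n : nat, is_sup_image (J i) (gam n) t.

Lemma gam_sup_gam n : gam_sup (gam n).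
Proof. by exists 0, n; apply: sup_id. Qed.

Lemma tame_gam u n : tame u -> bounded (u (gam n)) -> exists s : nat, u (gam n) = gam s.
Proof.
move=> tu; apply: (crit_tame (a := app u (J (2 ^ n)))).
  by apply: tame_app => //; apply: tame_J.
by have [eu _] := tu; apply: crit_app => //; apply: gam_crit.
Qed.

(** The supremum only depends on u below some gam, so u may be replaced by an
    iterate. *)
Lemma gam_sup_tame u n t : tame u -> bounded (u (gam n)) -> is_sup_image u (gam n) t -> gam_sup t.
Proof.
move=> tu bu ht; have [eu hu] := tu; have [s sE] := tame_gam tu bu.
have lt : s < (maxn s n).+1 by rewrite ltnS leq_maxl.
have [i hi] := hu (maxn s n).+1; exists i, n.
apply: (sup_agree eu (J_el i) (gam_lim _) hi) ht; last by rewrite sE; apply: gam_mono.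
by apply: gam_mono; rewrite ltnS leq_maxr.
Qed.

Lemma gam_sup_image (b : nat) t : gam_sup t -> gam_sup (J b t).
Proof.
move=> [i [n ht]]; have [s sE] := J_gam b n.
have := sup_app (J_el b) (J_el i) (gam_ord n) ht; rewrite sE.
apply: gam_sup_tame; first by apply: tame_app; apply: tame_J.
rewrite -sE (app_comm hL) //; apply: J_bounded; first exact: ord_el.
by apply: J_bounded => //; apply: gam_bounded.
Qed.

Lemma least_preimage_gam_sup (hTH : threshold_hypothesis) (k N i : nat) x :
  is_min_preimage (J i) (gam N) x -> ole x (gam k) -> gam_sup x.
Proof.
have [d] := ubnP k; elim: d k N i x => // d IH k N i x hd hx xk.
have [ox Jx mx] := hx.
(* The induction hypothesis allows gam k to be taken least above x. *)
have [[k' lt le]|nk] := classic (exists2 k' : nat, k' < k & ole x (gam k')).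
  by apply: (IH k' N i) => //; exact: (leq_trans lt hd).
have below (k' : nat) : k' < k -> gam k' ∈ x.
  move=> h; have [le|//] := ole_or_lt ox (gam_ord k').
  by case: nk; exists k'.
case: xk => [xk|/vval_inj ->]; last exact: gam_sup_gam.
have xN : ole x (gam N) by apply: (mx _ (gam_ord N)); apply: el_infl.
case: xN => [xN|/vval_inj ->]; last exact: gam_sup_gam.
pose a := i %% 2 ^ N; have ha : agree (gam N) (J i) (J a) := @J_mod N i.
have Jax : ole (gam N) (J a x) by apply: (agree_gam_ge _ _ ha).
have haN : 0 < a < 2 ^ N.
  rewrite ltn_mod expn_gt0 andbT lt0n; apply/eqP => e; rewrite e in Jax.
  exact: (ole_not_lt Jax xN).
(* Since J_a x < J_a (gam k), the value J_a (gam k) overshoots gam N. *)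
have hk1 : ole (gam N.+1) (J a (gam k)).
  have [s sE] := J_gam a k; rewrite sE; apply: gam_ole; apply: gam_lt_inv.
  apply: ole_lt_trans (gam_ord s) Jax _; rewrite -sE; exact: ((el_mem (J_el a) _ _).1 xk).
have hk2 m : m < k -> J a (gam m) ∈ gam N.
  move=> mk; have mx' := below m mk; apply: NNPP => h.
  have le := gam_not_lt (ord_el hL (J_el a) (gam_ord m)) h.
  have := agree_gam_ge (J_el a) (J_el i) (agree_sym ha) (leqnn N) (gam_ord m) le.
  by move/(mx _ (gam_ord m))/ole_not_lt; apply.
have [b0 [m0 [t0 [ht0 t0k Jt0]]]] := below_period hTH haN hk1 hk2.
have ot0 : ord t0 := ord_mem (gam_ord k) t0k.
have st0 : gam_sup t0 by exists b0, m0.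
have xt0 : ole x t0.
  by apply: mx => //; apply: (agree_gam_ge (J_el a) (J_el i) (agree_sym ha)).
have [|t [ot [[b [l ht]] xt] mt]] := @ex_least_ord U L (fun t => gam_sup t /\ ole x t).
  by exists t0.
have tk : t ∈ gam k := ole_lt_trans (gam_ord k) (mt t0 ot0 (conj st0 xt0)) t0k.
case: xt => [xt|/vval_inj ->]; last by exists b, l.
have [y yl xy] := sup_mem (J_el b) (gam_ord l) ht xt.
have oy : ord y := ord_mem (gam_ord l) yl.
have [_ /(_ N) [c hc]] := tame_comp (tame_J i) (tame_J b).
have eib := comp_elementary (J_el i) (J_el b).
have [|z hz] := @ex_least_ord U L (fun z => ole (gam N) (J c z)).
  by exists (gam N) => //; apply: el_infl.
have [oz Jz mz] := hz.
have zy : ole z y.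
  apply: mz => //; apply: (agree_gam_ge eib (J_el c) hc) => //=.
  apply: ole_trans Jx _; first by do !apply: ord_el => //.
  exact: el_ole.
(* Here the induction hypothesis becomes available: z < gam l and l < k. *)
have zl : z ∈ gam l := ole_lt_trans (gam_ord l) zy yl.
have lk : l < k.
  apply: gam_lt_inv; apply: ole_lt_trans (gam_ord k) _ tk.
  apply: (ole_sub (gam_ord l) ot) => u ul.
  have [w e] := ex_mem_V hL ul; rewrite -e in ul *.
  have ow : ord w := ord_mem (gam_ord l) ul.
  apply: ole_lt_trans ot (el_infl hL (J_el b) ow) _.
  exact: sup_lt (J_el b) (gam_lim l) ht ul.
have iz : gam_sup z.
  apply: (IH l N c); [exact: (leq_trans lk hd) | by split | by left].
have xbz : ole x (J b z).
  apply: mx; first exact: ord_el.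
  exact: (agree_gam_ge (J_el c) eib (agree_sym hc) (leqnn N) oz Jz).
have bzt : J b z ∈ t := sup_lt (J_el b) (gam_lim l) ht zl.
case: (ole_not_lt (mt (J b z) _ _) bzt); first exact: ord_el.
by split=> //; apply: gam_sup_image.
Qed.

(** * The two closures *)

(** Members of Gamma are critical points: a kappa is the one of a . j, and kappa is
    (j . j) kappa. *)
Lemma Gamma_gam x : Gamma j x <-> exists n, x = gam n.
Proof.
split=> [[k [a [hk' ha ->]]]|[n ->]].
  rewrite (crit_unique hk hk'); have ta := calA_tame ha; have [ea _] := ta.
  apply: (crit_tame (a := app a j)).
  - by apply: tame_app => //; rewrite -J1; apply: tame_J.
  - exact: crit_app.
  - by have [_ _ h _] := calA_moving ha; apply: h; [exact: (kap_ord 0) | exact: (bounded_kap 0)].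
case: n => [|n].
  exists kappa, (app j j); split=> //.
    by apply: calA_calA; apply: calA_gen.
  have h := crit_app hL ej ej hk; rewrite (crit_fixes h) //.
  exact: (crit_lt hL ej hk).
exists kappa, (J (2 ^ n.+1).-1); split=> //.
have : 0 < (2 ^ n.+1).-1 by rewrite -ltnS pow2S -{1}(expn0 2) ltn_exp2l.
by case: (2 ^ n.+1).-1 => // m _; apply: calA_J.
Qed.

Lemma least_preimage_agree a b t x : elementary a -> elementary b -> lim t -> agree t a b ->
  is_min_preimage a t x -> is_min_preimage b t x.
Proof.
move=> ea eb lt h [ox ax mx]; have ot := lim_ord lt.
have E c d y : elementary c -> elementary d -> agree t c d -> ord y ->
    ole t (c y) -> ole t (d y).
  move=> ec ed hcd oy cy; have [//|dy] := ole_or_lt ot (ord_el hL ed oy).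
  have yt : y ∈ t := ole_lt_trans ot (el_infl hL ed oy) dy.
  by rewrite -(agree_ord ed ec lt (agree_sym hcd) oy yt dy).
split=> //; first exact: E ax.
by move=> y oy /(E b a y eb ea (agree_sym h) oy); apply: mx.
Qed.

Lemma tame_least_preimage (hTH : threshold_hypothesis) u N x : tame u ->
  is_min_preimage u (gam N) x -> gam_sup x.
Proof.
move=> [eu hu] hx; have [i hi] := hu N.
have hx' := least_preimage_agree eu (J_el i) (gam_lim N) hi hx; have [_ _ mx] := hx'.
apply: (least_preimage_gam_sup hTH (k := N) hx'); apply: (mx _ (gam_ord N)); exact: el_infl.
Qed.

Lemma gam_sup_Sigma x : gam_sup x -> Sigma j x.
Proof.
move=> [[|i] [n hx]].
  rewrite (sup_unique hx (sup_id (gam_lim n))).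
  by apply: Sigma_Gamma; apply/Gamma_gam; exists n.
apply: Sigma_sup (calA_J i) _ hx; apply: Sigma_Gamma; apply/Gamma_gam; by exists n.
Qed.

Lemma Sigma_gam_sup x : Sigma j x -> gam_sup x.
Proof.
elim=> [y /Gamma_gam [n ->]|a y z ha _ [i [n hy]] hz]; first exact: gam_sup_gam.
have ta := calA_tame ha; have [ea _] := ta.
apply: (gam_sup_tame (u := a \o J i) (n := n)).
- by apply: tame_comp => //; apply: tame_J.
- have [_ _ h _] := calA_moving ha; apply: h; first by apply: ord_el.
  by apply: J_bounded => //; apply: gam_bounded.
have [oz ub mz] := hz; have [oy uby _] := hy; split=> // [x' xn|t ot h].
  by apply: ub; apply: sup_lt xn.
apply: mz => // w wy; have [v vn wv] := sup_mem (J_el i) (gam_ord n) hy wy.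
apply: ole_trans ot (el_ole ea wv) (h v vn).
Qed.

(** With w = J (2 ^ n), of critical point gam n, and v = w . a, the supremum of
    a[gam n] is the least ordinal that w sends to at least v (gam n). *)
Lemma gam_sup_Omega x : gam_sup x -> Omega j x.
Proof.
move=> hx; have Gn n : Gamma j (gam n) by apply/Gamma_gam; exists n.
have [[|i] [n ht]] := hx.
  by rewrite (sup_unique ht (sup_id (gam_lim n))); apply: Omega_Gamma.
pose w := J (2 ^ n); have ew : elementary w by exact: J_el.
pose v := app w (J i.+1); have ev : elementary v by apply: app_elementary.
have tv : tame v by apply: tame_app; apply: tame_J.
have Aw : calA j w by rewrite /w -pow2S; apply: calA_J.
have [s sE] : exists s : nat, v (gam n) = gam s.
  apply: tame_gam => //.
  have /calA_moving [_ _ h _] : calA j v by apply: calA_calA => //; apply: calA_J.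
  by apply: h => //; apply: gam_bounded.
have [ox ub mx] := ht.
apply: (Omega_min Aw (Omega_Gamma (Gn s))); rewrite -sE; split=> //.
  have [_ ub' _] := sup_app ew (J_el i.+1) (gam_ord n) ht.
  by apply: ub'; apply: (crit_lt hL ew (gam_crit n)).
move=> y oy le; have [//|yx] := ole_or_lt ox oy.
have [z zn yz] := sup_mem (J_el i.+1) (gam_ord n) ht yx.
case: (ole_not_lt le); have fz : w z = z := crit_fixes (gam_crit n) zn.
apply: ole_lt_trans (ord_el hL ev (gam_ord n)) (el_ole ew yz) _.
by rewrite -(app_comm hL) // fz -el_mem.
Qed.

(** Least preimages compose: a least preimage under a of a least preimage under u
    is one under u o a. *)
Lemma Omega_gam_sup (hTH : threshold_hypothesis) x : Omega j x -> gam_sup x.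
Proof.
move=> hx; suff [u [N [tu hu]]] : exists (u : T -> T) (N : nat),
    tame u /\ is_min_preimage u (gam N) x.
  exact: (tame_least_preimage hTH tu hu).
elim: hx => [y /Gamma_gam [n ->]|a y z ha _ [u [N [tu hu]]] hz].
  exists (J 0), n; split; first exact: tame_J.
  by split; [exact: gam_ord | right | ].
have ta := calA_tame ha; have [[ea _] [eu _]] := (ta, tu).
exists (u \o a), N; split; first exact: tame_comp.
have [oy uy my] := hu; have [oz az mz] := hz; split=> // [|w ow h] /=.
  by apply: ole_trans uy (el_ole eu az); do !apply: ord_el => //.
by apply: mz => //; apply: my => //; apply: ord_el.
Qed.

End Iterates.

Theorem theorem3p9 (U : zfc_universe) (L : U) (hL : limit_ordinal L)
    (j : V L -> V L) (hj : elementary j) (hj1 : exists x : V L, j x <> x)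
    (hTH : threshold_hypothesis) :
  (forall alpha : V L, Sigma j alpha <-> Omega j alpha) /\
  (forall (u : V L -> V L) (lambda xi : V L),
     calP j u -> Gamma j lambda -> is_min_preimage u lambda xi -> Sigma j xi).
Proof.
have [kappa hk] := ex_crit hL hj hj1; split.
  move=> x; split=> [/(Sigma_gam_sup hL hj hk)|/(Omega_gam_sup hL hj hk hTH)].
    exact: gam_sup_Omega.
  exact: gam_sup_Sigma.
move=> u lambda xi hu /(Gamma_gam hL hj hk) [n ->] hxi.
have tu : tame hL j kappa u by apply: calP_tame hu.
exact: (gam_sup_Sigma hj hk (tame_least_preimage hj hk hTH tu hxi)).
Qed.
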